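(* Let $G=(V,E)$ be a loopless graph with possible multiple edges. Then $\tau_{\mathbb Z}(G,q)$ and $\bar\tau_{\mathbb Z}(G,q)$ are polynomial functions of degree $r(G)$ in positive integers $q$, and (writing $\tau_{\mathbb Z}(G,t)$, $\bar\tau_{\mathbb Z}(G,t)$ for the corresponding polynomials in $t$) can be written as $$\tau_{\mathbb Z}(G,t)=\sum_{\varepsilon\in A\mathcal O(G)}\tau_{\mathbb Z}(G,\varepsilon;t),\qquad \bar\tau_{\mathbb Z}(G,t)=\sum_{\varepsilon\in A\mathcal O(G)}\bar\tau_{\mathbb Z}(G,\varepsilon;t).$$ Moreover, for each orientation $\varepsilon\in A\mathcal O(G)$ we have the reciprocity laws $$\tau_{\mathbb Z}(G,\varepsilon;-t)=(-1)^{r(G)}\bar\tau_{\mathbb Z}(G,\varepsilon;t),\qquad \tau_{\mathbb Z}(G,-t)=(-1)^{r(G)}\bar\tau_{\mathbb Z}(G,t).$$ In particular, $\bar\tau_{\mathbb Z}(G,\varepsilon;0)=(-1)^{r(G)}\tau_{\mathbb Z}(G,\varepsilon;0)=1$ for each $\varepsilon\in A\mathcal O(G)$, and $|\tau_{\mathbb Z}(G,0)|$ is the number of acyclic orientations of $G$.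
   Context: Graphs are finite. $r(G)=|V|-k(G)$, where $k(G)$ is the number of connected components of $G$. An orientation $\varepsilon$ of $G$ assigns an arrow $\varepsilon(x)$ to each edge $x$ (two choices for an edge with two distinct endpoints). A circuit is a connected subgraph with degree 2 at every vertex (two parallel edges form a circuit); a direction of a circuit $C$ is an orientation $\varepsilon_C$ of $C$ with one arrow in and one arrow out at every vertex; the pair $(C,\varepsilon_C)$ is called a directed circuit. An orientation $\varepsilon$ of $G$ is acyclic if there is no circuit $C$ on which the restriction of $\varepsilon$ is a direction of $C$. $A\mathcal O(G)$ is the set of acyclic orientations of $G$. For orientations $\varepsilon_i$ of subgraphs $H_i$ of $G$ ($i=1,2$), the coupling $[\varepsilon_1,\varepsilon_2]:E\to\mathbb Z$ is $1$ at $x\in E(H_1)\cap E(H_2)$ if $\varepsilon_1(x)=\varepsilon_2(x)$, $-1$ at $x\in E(H_1)\cap E(H_2)$ if $\varepsilon_1(x)\ne\varepsilon_2(x)$, and $0$ otherwise. For an abelian group $A$, a tension of $(G,\varepsilon)$ with values in $A$ is $f:E\to A$ such that $\sum_{x\in C}[\varepsilon,\varepsilon_C](x)f(x)=0$ for every circuit $C$ of $G$ with direction $\varepsilon_C$; $T(G,\varepsilon;A)$ is the group of all such tensions. It is nowhere-zero if $f(x)\neq0$ for all $x\in E$. For a positive integer $q$, $\tau_{\mathbb Z}(G,q)$ is the number of nowhere-zero $f\in T(G,\varepsilon;\mathbb Z)$ with $|f(x)|<q$ for all $x\in E$ (this number does not depend on the chosen orientation $\varepsilon$), and $$\bar\tau_{\mathbb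 Z}(G,q)=\#\{(\varepsilon,f):\varepsilon\in A\mathcal O(G),\ f\in T(G,\varepsilon;\mathbb Z),\ 0\le f(x)\le q\text{ for all }x\in E\}.$$ For $\varepsilon\in A\mathcal O(G)$, the tension polytope $\bar\Delta^+(G,\varepsilon)\subset T(G,\varepsilon;\mathbb R)$ is the polytope whose vertices are the tensions $f\in T(G,\varepsilon;\mathbb R)$ with $f(x)\in\{0,1\}$ for all $x$; equivalently $\{f\in T(G,\varepsilon;\mathbb R):0\le f(x)\le1\ \forall x\in E\}$. Its interior in $T(G,\varepsilon;\mathbb R)$ is $\Delta^+(G,\varepsilon)=\{f\in T(G,\varepsilon;\mathbb R):0<f(x)<1\ \forall x\in E\}$. $\tau_{\mathbb Z}(G,\varepsilon;t)$ and $\bar\tau_{\mathbb Z}(G,\varepsilon;t)$ are the Ehrhart polynomials of $\Delta^+(G,\varepsilon)$ and $\bar\Delta^+(G,\varepsilon)$, i.e. the polynomials with $\tau_{\mathbb Z}(G,\varepsilon;q)=|q\Delta^+(G,\varepsilon)\cap\mathbb Z^E|$ and $\bar\tau_{\mathbb Z}(G,\varepsilon;q)=|q\bar\Delta^+(G,\varepsilon)\cap\mathbb Z^E|$ for all positive integers $q$. *)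

(* Defs.v *)
From mathcomp Require Import all_boot all_order all_algebra.
From mathcomp Require Import finmap.
From mathcomp Require Import boolp classical_sets functions cardinality reals.

Set Implicit Arguments.
Unset Strict Implicit.
Unset Printing Implicit Defensive.

Import Order.TTheory GRing.Theory Num.Theory.
Local Open Scope ring_scope.

(* Loops are the edges with a single endpoint. *)
Record multigraph := Multigraph {
  vertex : finType;
  edge : finType;
  ends : edge -> {set vertex};
  ends_card : forall x, (0 < #|ends x| <= 2)%N
}.

Definition loopless (G : multigraph) : Prop :=
  forall x : edge G, #|ends x| = 2%N.

(* A pair (W, F) of a vertex set and an edge set; see [is_subgraph]. *)
Definition subgraph (G : multigraph) : finType :=
  ({set vertex G} * {set edge G})%type.

Definition whole (G : multigraph) : subgraph G :=
  ([set: vertex G]%SET, [set: edge G]%SET).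

Definition is_subgraph (G : multigraph) (H : subgraph G) : bool :=
  [forall x in H.2, ends x \subset H.1].

Definition adjacent (G : multigraph) (F : {set edge G}) : rel (vertex G) :=
  fun u v => [exists x in F, ends x == [set u; v]%SET].

Definition connected_subgraph (G : multigraph) (H : subgraph G) : bool :=
  (H.1 != finset.set0) &&
  [forall u in H.1, forall v in H.1, connect (adjacent H.2) u v].

Definition components (G : multigraph) : nat :=
  n_comp (adjacent [set: edge G]%SET) predT.

Definition rank (G : multigraph) : nat := (#|vertex G| - components G)%N.

(* A loop contributes 2 to the degree of its endpoint. *)
Definition degree (G : multigraph) (H : subgraph G) (v : vertex G) : nat :=
  (\sum_(x in H.2 | v \in ends x) if #|ends x| == 1 then 2 else 1)%N.

Definition is_circuit (G : multigraph) (C : subgraph G) : bool :=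
  [&& is_subgraph C, connected_subgraph C
    & [forall v in C.1, degree C v == 2%N]].

(* An arrow is a pair (tail, head).  Arrow assignments are total on E; as an
   orientation of a subgraph (W, F), only the values on F are meaningful. *)
Definition arrows (G : multigraph) : finType :=
  {ffun edge G -> vertex G * vertex G}.

Definition is_orientation (G : multigraph) (H : subgraph G) (e : arrows G) :
    bool :=
  [forall x in H.2, [set (e x).1; (e x).2]%SET == ends x].

Definition indegree (G : multigraph) (H : subgraph G) (e : arrows G)
    (v : vertex G) : nat := #|[set x in H.2 | (e x).2 == v]%SET|.

Definition outdegree (G : multigraph) (H : subgraph G) (e : arrows G)
    (v : vertex G) : nat := #|[set x in H.2 | (e x).1 == v]%SET|.

Definition is_direction (G : multigraph) (C : subgraph G) (e : arrows G) :
    bool :=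
  is_orientation C e &&
  [forall v in C.1, (indegree C e v == 1%N) && (outdegree C e v == 1%N)].

Definition acyclic (G : multigraph) (e : arrows G) : bool :=
  ~~ [exists C : subgraph G, is_circuit C && is_direction C e].

Definition acyclic_orientations (G : multigraph) : {set arrows G} :=
  [set e : arrows G | is_orientation (whole G) e && acyclic e]%SET.

Definition coupling (G : multigraph) (H1 : subgraph G) (e1 : arrows G)
    (H2 : subgraph G) (e2 : arrows G) (x : edge G) : int :=
  if (x \in H1.2) && (x \in H2.2) then
    if e1 x == e2 x then 1 else - 1
  else 0.

Definition is_tension (G : multigraph) (A : zmodType) (e : arrows G)
    (f : {ffun edge G -> A}) : Prop :=
  forall (C : subgraph G) (eC : arrows G),
    is_circuit C -> is_direction C eC ->
    \sum_(x in C.2) f x *~ coupling (whole G) e C eC x = 0.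

(* [fset_set] sends an infinite set to the empty finite set; the sets counted
   below are bounded sets of integer points, hence finite. *)
Definition count (T : choiceType) (S : set T) : nat := #|` fset_set S|%fset.

Definition tauZ (G : multigraph) (e : arrows G) (q : nat) : nat :=
  count [set f : {ffun edge G -> int} |
    [/\ is_tension e f, (forall x, f x != 0) & (forall x, `|f x| < q%:Z)]
  ]%classic.

Definition bar_tauZ (G : multigraph) (q : nat) : nat :=
  count [set ef : arrows G * {ffun edge G -> int} |
    [/\ ef.1 \in acyclic_orientations G, is_tension ef.1 ef.2
      & forall x, 0 <= ef.2 x <= q%:Z]
  ]%classic.

Definition convex_hull (R : realType) (E : finType) (S : set {ffun E -> R}) :
    set {ffun E -> R} :=
  [set f : {ffun E -> R} | exists (n : nat) (w : 'I_n -> R) (p : 'I_n -> {ffun E -> R}),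
    [/\ forall i, S (p i), forall i, 0 <= w i, \sum_i w i = 1
      & forall x, f x = \sum_i w i * p i x] ]%classic.

Definition closed_tension_polytope (R : realType) (G : multigraph)
    (e : arrows G) : set {ffun edge G -> R} :=
  convex_hull [set f : {ffun edge G -> R} |
    is_tension e f /\ forall x, f x = 0 \/ f x = 1]%classic.

Definition open_tension_polytope (R : realType) (G : multigraph)
    (e : arrows G) : set {ffun edge G -> R} :=
  [set f : {ffun edge G -> R} |
    is_tension e f /\ forall x, 0 < f x < 1]%classic.

Arguments closed_tension_polytope R {G} e.
Arguments open_tension_polytope R {G} e.

Definition dilation (R : realType) (E : finType) (q : nat)
    (P : set {ffun E -> R}) : set {ffun E -> R} :=
  [set [ffun x => q%:R * f x] | f in P]%classic.

Definition integer_points (R : realType) (E : finType) : set {ffun E -> R} :=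
  [set f : {ffun E -> R} | forall x, f x \is a Num.int]%classic.

Arguments integer_points R E : clear implicits.

Definition ehrhart_polynomial (R : realType) (E : finType)
    (P : set {ffun E -> R}) (p : {poly R}) : Prop :=
  forall q : nat, (0 < q)%N ->
    p.[q%:R] = (count (dilation q P `&` integer_points R E)%classic)%:R.

(* Main.v *)
(** A tension is the coboundary f = dp of a vertex potential p.  Fix an acyclic
orientation e and write p = q a + b with 0 <= b < q.  Then 0 < f < q says that
da is a 0/1 tension, the indicator of an edge set A, and that b strictly
increases along the arrows of e_A, the (again acyclic) reorientation of e along
A; weak inequalities correspond to weakly increasing b with the same sets A.
So the q-th dilates of the open and closed polytopes are counted by sums over A
of strict and weak order polynomials of e_A, up to the factor q^k(G) for the
free values of b at one base point per component, and reciprocity follows from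
that of order polynomials.  Normalising instead b = q - 1 at the base points
exhibits the strict count as a polynomial, whose value at 0 is, up to the sign
(-1)^r(G), the number of A such that the sinks of e_A are exactly the base
points; there is exactly one.  The sums over acyclic orientations arise by
making a nowhere-zero tension positive. *)

Require Import Defs.
From mathcomp Require Import finmap.
From mathcomp Require Import boolp classical_sets cardinality reals.
From mathcomp Require Import all_boot all_order all_algebra.
From mathcomp Require Import zify.

Set Implicit Arguments.
Unset Strict Implicit.
Unset Printing Implicit Defensive.

Import Order.TTheory GRing.Theory Num.Theory.
Local Open Scope ring_scope.

(** * Strict and weak order polynomials of an acyclic relation, and their reciprocity *)

Section OrderPolynomials.
Variables (R : numFieldType) (V : finType).

Lemma comp_polyXD1_exp (n : nat) :
  exists2 r : {poly R}, (size r <= n)%N &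
    ('X^(n.+1) \Po ('X + 1)) - 'X^(n.+1) = 'X^n *+ n.+1 + r :> {poly R}.
Proof.
have E : 'X^(n.+1) \Po ('X + 1) = \sum_(i < n.+2) 'X^i *+ 'C(n.+1, i) :> {poly R}.
  rewrite comp_Xn_poly addrC exprDn; apply: eq_bigr => i _.
  by rewrite expr1n mul1r.
exists (\sum_(i < n) 'X^i *+ 'C(n.+1, i)).
  apply/leq_sizeP => j nj; rewrite coef_sum big1 // => i _.
  by rewrite coefMn coefXn gtn_eqF ?mul0rn // (leq_trans (ltn_ord i)).
rewrite E !big_ord_recr /= binn binSn mulr1n addrK.
exact: addrC.
Qed.

(** Discrete integration, by induction on the size bound: a multiple of the difference of
    ['X^(n.+1)] removes the top coefficient. The last clause carries the sign of the leading
    coefficient from [p] to [P]. *)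
Lemma antidifference (n : nat) (p : {poly R}) :
  (size p <= n)%N ->
  exists P : {poly R},
    [/\ P \Po ('X + 1) - P = p, P.[0] = 0, (size P <= n.+1)%N
      & P`_n *+ n = p`_n.-1].
Proof.
elim: n p => [|n IHn] p.
  rewrite leqn0 size_poly_eq0 => /eqP ->; exists 0.
  by rewrite comp_poly0 subr0 horner0 size_poly0 mulr0n coef0.
move=> szp; have [r szr Er] := comp_polyXD1_exp n.
pose c := p`_n / n.+1%:R.
have n1 : n.+1%:R != 0 :> R by rewrite pnatr_eq0.
have cn : c *+ n.+1 = p`_n by rewrite -mulr_natr mulfVK.
pose p' := p - c *: ('X^n *+ n.+1) - c *: r.
have szp' : (size p' <= n)%N.
  apply/leq_sizeP => j; rewrite leq_eqVlt => /orP[/eqP <-|nj].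
    rewrite !coefB !coefZ coefMn coefXn eqxx mulr_natr cn subrr sub0r.
    by rewrite (leq_sizeP _ _ szr) // mulr0 oppr0.
  rewrite !coefB !coefZ coefMn coefXn gtn_eqF // mul0rn mulr0 subr0.
  rewrite (leq_sizeP _ _ szp) // (leq_sizeP _ _ szr) ?(ltnW nj) //.
  by rewrite mulr0 subr0.
have [P [EP P0 szP _]] := IHn _ szp'.
exists (P + c *: 'X^(n.+1)); split.
- rewrite comp_polyD comp_polyZ opprD addrACA EP -scalerBr Er scalerDr.
  by rewrite /p' -[p - _ - _]addrA -opprD subrK.
- by rewrite hornerD hornerZ hornerXn expr0n P0 mulr0 addr0.
- apply: (leq_trans (size_polyD _ _)); rewrite geq_max (leqW szP) /=.
  by rewrite (leq_trans (size_scale_leq _ _)) // size_polyXn.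
- rewrite coefD coefZ coefXn eqxx mulr1 (leq_sizeP _ _ szP) // add0r.
  exact: cn.
Qed.

Variable D : rel V.

(** The sum expands the product over all [v] of 1 - [v in J], which has a zero factor unless [J] is
    empty. *)
Lemma sum_sign_subset (T : comNzRingType) (J : {set V}) :
  \sum_(I : {set V} | I \subset J) (-1) ^+ #|I| = (J == set0)%:R :> T.
Proof.
transitivity (\prod_(v : V) (- (v \in J)%:R + 1) : T).
  rewrite bigA_distr /= big_mkcond /=; apply: eq_bigr => I _.
  rewrite -big_mkcond /=; case: (boolP (I \subset J)) => [/subsetP IJ|].
    by rewrite -prodr_const; apply: eq_bigr => v /IJ ->.
  by move=> /subsetPn[v vI vJ]; rewrite (bigD1 v) //= (negbTE vJ) oppr0 mul0r.
case: (set_0Vmem J) => [->|[v vJ]].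
  by rewrite eqxx big1 // => v _; rewrite inE oppr0 add0r.
rewrite (bigD1 v) //= vJ addNr mul0r; case: eqP => // J0.
by rewrite J0 inE in vJ.
Qed.

Definition sinks (U : {set V}) : {set V} :=
  [set v in U | [forall w in U, ~~ D v w]].

(* Maps U -> {0, ..., j-1}, extended by M outside U; meant for j <= M + 1. *)
Definition monotone_maps (strict : bool) (M : nat) (U : {set V}) (j : nat) :
    {set {ffun V -> 'I_M.+1}} :=
  [set b : {ffun V -> 'I_M.+1} |
    [forall v, if v \in U then (b v < j)%N else b v == ord_max] &&
    [forall v in U, forall w in U, D v w ==>
       (if strict then b v < b w else b v <= b w)%N]].

Lemma monotone_mapsP (strict : bool) (M : nat) (U : {set V}) (j : nat)
    (b : {ffun V -> 'I_M.+1}) :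
  reflect [/\ forall v, v \in U -> (b v < j)%N,
              forall v, v \notin U -> b v = ord_max
            & forall v w, v \in U -> w \in U -> D v w ->
                (if strict then b v < b w else b v <= b w)%N]
    (b \in monotone_maps strict M U j).
Proof.
rewrite inE; apply: (iffP andP) => [[/forallP bj /forall_inP bD]|[bj bM bD]].
  split=> [v vU|v /negbTE vU|v w vU wU]; first by have:= bj v; rewrite vU.
    by have:= bj v; rewrite vU => /eqP.
  by have /forall_inP/(_ w wU)/implyP := bD v vU.
split; first by apply/forallP => v; case: ifP => [/bj|/negbT/bM ->].
apply/forall_inP => v vU; apply/forall_inP => w wU; apply/implyP.
exact: bD.
Qed.

(** Forgetting the values on [I] is a bijection: arcs out of [I] impose nothing because [I] consists
    of sinks, and arcs into [I] hold automatically because the other values are below [k]. With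
    [k = j] the set [I] is the whole top level; with [k = j.+1] it is only contained in it. *)
Lemma card_peel (strict : bool) (M : nat) (U I : {set V}) (j k : nat) :
  (j <= M)%N -> I \subset sinks U -> (k <= j.+1)%N -> strict ==> (k <= j)%N ->
  #|[set b in monotone_maps strict M U j.+1 |
      [forall v in U, if v \in I then b v == j :> nat else (b v < k)%N]]|
  = #|monotone_maps strict M (U :\: I) k|.
Proof.
move=> jM IU kj kj'.
pose psi (b : {ffun V -> 'I_M.+1}) : {ffun V -> 'I_M.+1} :=
  [ffun v => if v \in I then inord j else b v].
have sIU v : v \in I -> v \in U by move/(subsetP IU); rewrite inE => /andP[].
have psi_inj : {in monotone_maps strict M (U :\: I) k &, injective psi}.
  move=> b b' /monotone_mapsP[_ bM _] /monotone_mapsP[_ bM' _] /ffunP E.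
  apply/ffunP => v; have := E v; rewrite !ffunE; case: ifP => // vI _.
  by rewrite bM ?bM' // inE vI.
rewrite -(card_in_imset psi_inj); apply: eq_card => b; rewrite inE.
apply/andP/imsetP => [[/monotone_mapsP[bj bM bD] /forall_inP bI]|[c]].
  exists [ffun v => if v \in I then ord_max else b v].
    apply/monotone_mapsP; split=> [v|v|v w]; rewrite ?inE.
    - by move=> /andP[vI vU]; rewrite ffunE (negbTE vI); have:= bI v vU; rewrite (negbTE vI).
    - rewrite ffunE; case: ifP => //= _ vU; exact: bM.
    - move=> /andP[vI vU] /andP[wI wU]; rewrite !ffunE (negbTE vI) (negbTE wI).
      exact: bD.
  apply/ffunP => v; rewrite !ffunE; case: ifP => vI; last by rewrite vI.
  have := bI v (sIU v vI); rewrite vI => /eqP bv; apply: val_inj.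
  by rewrite /= inordK ?ltnS.
move=> /monotone_mapsP[cj cM cD] ->; split.
  apply/monotone_mapsP; split=> [v vU|v vU|v w vU wU Dvw]; rewrite !ffunE.
  - case: ifP => vI; first by rewrite inordK.
    by rewrite (leq_trans _ kj) // cj // inE vI.
  - case: ifP => [/sIU vU'|vI]; first by rewrite vU' in vU.
    by rewrite cM // inE (negbTE vU) andbF.
  - case: (boolP (v \in I)) => [vI|vI].
      have := subsetP IU v vI; rewrite inE vU => /forall_inP/(_ w wU).
      by rewrite Dvw.
    have cv : (c v < k)%N by rewrite cj // inE vI.
    case: (boolP (w \in I)) => wI /=; last by apply: cD; rewrite ?inE ?vI ?wI.
    rewrite inordK //; case: (strict) kj' => /= kj'; first exact: leq_trans kj'.
    by rewrite -ltnS (leq_trans cv).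
apply/forall_inP => v vU; rewrite !ffunE; case: (boolP (v \in I)) => vI /=.
  by rewrite inordK.
by rewrite cj // inE vI.
Qed.

(** Maps are sorted by the set on which the top value [j] is attained; strictness makes it a set of
    sinks. *)
Lemma card_strict_recl (M : nat) (U : {set V}) (j : nat) : (j <= M)%N ->
  #|monotone_maps true M U j.+1| =
  (\sum_(I : {set V} | I \subset sinks U) #|monotone_maps true M (U :\: I) j|)%N.
Proof.
move=> jM; rewrite -sum1_card.
pose top (b : {ffun V -> 'I_M.+1}) := [set v in U | b v == j :> nat].
rewrite (partition_big top (fun I => I \subset sinks U)) /=.
  apply: eq_bigr => I IU; rewrite -(@card_peel true M U I j j) //=.
  rewrite -sum1_card; apply: eq_bigl => b; rewrite [in RHS]inE.
  case bU: (b \in _) => //=; have /monotone_mapsP[bj _ _] := bU.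
  apply/eqP/forall_inP => [<- v vU|bI].
    rewrite inE vU /=; case: ifP => // /negbT; have := bj v vU.
    by rewrite ltnS leq_eqVlt => /orP[->|].
  apply/setP => v; rewrite inE; apply/andP/idP => [[vU bv]|vI].
    by have := bI v vU; case: ifP => //; rewrite (eqP bv) ltnn.
  have vU : v \in U by have := subsetP IU v vI; rewrite inE => /andP[].
  by split=> //; have := bI v vU; rewrite vI.
move=> b /monotone_mapsP[bj _ bD]; apply/subsetP => v.
rewrite !inE => /andP[vU /eqP bv]; rewrite vU; apply/forall_inP => w wU.
apply/negP => Dvw; have := leq_trans (bD v w vU wU Dvw) (bj w wU).
by rewrite bv ltnn.
Qed.

(** On a finite vertex set this is acyclicity of [D]. *)
Hypothesis sinks_exist : forall U : {set V}, U != set0 -> sinks U != set0.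

(* Inclusion-exclusion over the sinks on which the top value j is attained. *)
Lemma card_weak_recl (M : nat) (U : {set V}) (j : nat) : (j <= M)%N ->
  #|monotone_maps false M U j|%:Z =
  \sum_(I : {set V} | I \subset sinks U)
    (-1) ^+ #|I| * #|monotone_maps false M (U :\: I) j.+1|%:Z.
Proof.
move=> jM; pose top (b : {ffun V -> 'I_M.+1}) := [set v in sinks U | b v == j :> nat].
transitivity (\sum_(I : {set V} | I \subset sinks U)
   \sum_(b in monotone_maps false M U j.+1 | I \subset top b) (-1) ^+ #|I| : int); last first.
  apply: eq_bigr => I IU; rewrite sumr_const -mulr_natr; congr (_ * _).
  rewrite natz -(@card_peel false M U I j j.+1) //=; congr (Posz _).
  apply: eq_card => b; rewrite [in RHS]in_set.
  transitivity ((b \in monotone_maps false M U j.+1) && (I \subset top b)) => //.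
  case bU: (b \in monotone_maps false M U j.+1) => //=; have /monotone_mapsP[bj _ _] := bU.
  apply/subsetP/forall_inP => [Ib v vU|bI v vI].
    case: ifP => [/Ib|_]; last exact: bj.
    by rewrite inE => /andP[].
  have vS := subsetP IU v vI; rewrite inE vS /=.
  by have := bI v; rewrite vI; apply; move: vS; rewrite inE => /andP[].
rewrite (exchange_big_dep (mem (monotone_maps false M U j.+1))) /=; last first.
  by move=> I b _ /andP[].
transitivity (\sum_(b in monotone_maps false M U j.+1) (top b == set0)%:R : int).
  rewrite -natz -sum1_card natr_sum [RHS]big_mkcond [LHS]big_mkcond /=.
  apply: eq_bigr => b _; case: (boolP (b \in monotone_maps false M U j)).
    move=> /monotone_mapsP[bj bM bD]; case: ifP => [_|/negP[]].
      case: eqP => //= /eqP/set0Pn[v]; rewrite !inE => /andP[/andP[/bj + _] /eqP bv].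
      by rewrite bv ltnn.
    by apply/monotone_mapsP; split=> // v /bj/ltnW.
  move=> bj; case: ifP => // /monotone_mapsP[bj1 bM bD]; case: eqP => //= top0.
  case/negP: bj; apply/monotone_mapsP; split=> // v vU; rewrite ltn_neqAle -ltnS bj1 // andbT.
  (* A sink of the level set at [j] is a sink of [U]: an arc from it to another vertex of [U] ends
     at a value at least [j], hence again in the level set. *)
  apply/negP => bv; pose T := [set w in U | b w == j :> nat].
  have : T != set0 by apply/set0Pn; exists v; rewrite inE vU.
  move=> /sinks_exist/set0Pn[w]; rewrite !inE => /andP[/andP[wU /eqP bw] /forall_inP wD].
  move/setP/(_ w): top0; rewrite !inE wU bw eqxx andbT /= => /negP; case.
  apply/forall_inP => u uU; apply/negP => Dwu; have := bD w u wU uU Dwu.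
  rewrite bw leq_eqVlt ltnNge -ltnS bj1 // orbF => /eqP bu.
  by have := wD u; rewrite inE uU -bu eqxx Dwu => /(_ isT).
apply: eq_bigr => b bU; rewrite -sum_sign_subset; apply: eq_bigl => I.
rewrite bU /=; apply/idP/andP => [Ib|[] //]; split=> //.
by apply: (subset_trans Ib); apply/subsetP => v; rewrite inE => /andP[].
Qed.

Lemma card_monotone_maps_set0 (strict : bool) (M j : nat) :
  #|monotone_maps strict M set0 j| = 1%N.
Proof.
rewrite -(cards1 ([ffun=> ord_max] : {ffun V -> 'I_M.+1})); apply: eq_card => b.
rewrite [in RHS]inE; apply/monotone_mapsP/eqP => [[_ bM _]|->].
  by apply/ffunP => v; rewrite ffunE bM // inE.
by split=> [v|v _|v w]; rewrite ?inE // ffunE.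
Qed.

Lemma card_monotone_maps0 (strict : bool) (M : nat) (U : {set V}) :
  U != set0 -> #|monotone_maps strict M U 0| = 0%N.
Proof.
move=> /set0Pn[v vU]; apply: eq_card0 => b; apply/negP => /monotone_mapsP[bj _ _].
by have := bj v vU.
Qed.

Lemma card_monotone_maps1 (U : {set V}) : #|monotone_maps false 0 U 1| = 1%N.
Proof.
rewrite -[RHS](cards1 ([ffun=> ord_max] : {ffun V -> 'I_1})); apply: eq_card => b.
rewrite [in RHS]inE; apply/monotone_mapsP/eqP => [_|->].
  by apply/ffunP => v; rewrite ffunE !ord1.
by split=> [v|v _|v w] *; rewrite !ffunE.
Qed.

(** The second clause is Stanley's reciprocity. The last two fix the degree with a positive leading
    coefficient, so that top terms do not cancel when such polynomials are added. *)
Definition is_order_polynomial (U : {set V}) (S : {poly R}) : Prop :=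
  [/\ forall M j, (j <= M.+1)%N -> S.[j%:R] = #|monotone_maps true M U j|%:R,
      forall M j, (j <= M.+1)%N ->
        S.[- j%:R] = (-1) ^+ #|U| * #|monotone_maps false M U j|%:R,
      (size S <= #|U|.+1)%N
    & 0 < S`_#|U|].

(** Both recursions are one difference equation: S_U(x+1) - S_U(x) is the sum of S_(U\I)(x) over the
    nonempty sets I of sinks. The strict counts read it upwards from 0, the weak counts
    downwards. *)
Lemma order_polynomial_exists (U : {set V}) :
  exists S, is_order_polynomial U S.
Proof.
have [n] := ubnP #|U|; elim: n U => // n IHn U; rewrite ltnS => Un.
have [->|U0] := eqVneq U set0.
  exists 1; split=> [M j _|M j _||].
  - by rewrite hornerC card_monotone_maps_set0.
  - by rewrite hornerC card_monotone_maps_set0 cards0 mulr1.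
  - by rewrite size_poly1 cards0.
  - by rewrite cards0 coef1 ltr01.
have sU (I : {set V}) : I \subset sinks U -> I \subset U.
  by move=> IU; apply: (subset_trans IU); apply/subsetP => v; rewrite inE => /andP[].
have cU (I : {set V}) : I \subset sinks U -> (#|U :\: I| + #|I| = #|U|)%N.
  by move=> /sU IU; rewrite cardsD (setIidPr IU) subnK // subset_leq_card.
have [|S HS] := @fin_all_exists _ (fun=> {poly R}) (fun (I : {set V}) S =>
    I \subset sinks U -> I != set0 -> is_order_polynomial (U :\: I) S).
  move=> I; case: (boolP (I \subset sinks U)) => IU; last by exists 0.
  have [->|I0] := eqVneq I set0; first by exists 0.
  have [|S HS] := IHn (U :\: I); last by exists S.
  by rewrite (leq_trans _ Un) // -(cU I IU) -addn1 leq_add2l card_gt0.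
pose p := \sum_(I : {set V} | (I \subset sinks U) && (I != set0)) S I.
have szp : (size p <= #|U|)%N.
  apply: (leq_trans (size_sum _ _ _)); apply/bigmax_leqP => I /andP[IU I0].
  have [_ _ sz _] := HS I IU I0; apply: (leq_trans sz).
  by rewrite -(cU I IU) -addn1 leq_add2l card_gt0.
have [P [EP P0 szP cP]] := antidifference szp; exists P.
have hE x : P.[x + 1] = P.[x] + p.[x].
  by rewrite -EP hornerD hornerN horner_comp hornerD hornerX hornerC [RHS]addrC subrK.
split=> //.
- move=> M; elim=> [_|j IHj jM]; first by rewrite P0 card_monotone_maps0.
  rewrite -natr1 hE IHj ?(ltnW jM) // card_strict_recl //.
  rewrite (bigD1 set0) ?sub0set //= setD0 natrD; congr (_ + _).
  rewrite horner_sum natr_sum; apply: eq_bigr => I /andP[IU I0].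
  by have [+ _ _ _] := HS I IU I0; apply; exact: ltnW.
- move=> M; elim=> [_|j IHj jM].
    by rewrite oppr0 P0 card_monotone_maps0 // mulr0.
  (* At x = -(j+1) the difference equation becomes the weak recursion; the signs agree because
     [#|U|] is the sum of [#|U :\: I|] and [#|I|]. *)
  have := hE (- j.+1%:R); rewrite -[in LHS]natr1 opprD addrNK IHj ?(ltnW jM) //.
  move=> /eqP; rewrite -subr_eq => /eqP <-.
  have := @card_weak_recl M U j jM; move/(congr1 (intr : int -> R)).
  rewrite (bigD1 set0) ?sub0set //= setD0 cards0 mul1r rmorphD rmorph_sum /=.
  rewrite -!pmulrn => ->; rewrite mulrDr -[RHS]addr0 -addrA; congr (_ + _).
  apply/eqP; rewrite subr_eq0 mulr_sumr horner_sum; apply/eqP.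
  apply: eq_bigr => I /andP[IU I0]; have [_ + _ _] := HS I IU I0.
  move=> /(_ M j.+1 jM) ->; rewrite rmorphM rmorphXn rmorphN1 mulrA.
  by rewrite -(cU I IU) exprD -[X in X * _ = _]mulrA -expr2 sqrr_sign mulr1 /= pmulrn.
(* Only one-element sets [I] contribute in degree [#|U|.-1], and any sink provides one. *)
- have [v vS] := set0Pn _ (sinks_exist U0).
  have n0 : (0 < #|U|)%N by rewrite card_gt0.
  rewrite -(pmulrn_lgt0 _ n0) cP coef_sum.
  have vU1 : [set v] \subset sinks U by rewrite sub1set.
  have v0 : [set v] != set0 by apply/set0Pn; exists v; rewrite inE.
  have c1 : #|U :\: [set v]| = #|U|.-1 by rewrite -(cU _ vU1) cards1 addn1.
  rewrite (bigD1 [set v]) ?vU1 ?v0 //= ltr_pwDl //.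
    by have [_ _ _] := HS _ vU1 v0; rewrite c1.
  apply: sumr_ge0 => I /andP[/andP[IU I0] _]; have [_ _ sz co] := HS I IU I0.
  have : (#|U :\: I| <= #|U|.-1)%N.
    by rewrite -ltnS prednK // -(cU I IU) -addn1 leq_add2l card_gt0.
  rewrite leq_eqVlt => /orP[/eqP <-|lt]; first exact: ltW.
  by rewrite (leq_sizeP _ _ sz).
Qed.

End OrderPolynomials.

(** * Circuits, directed cycles, and tensions as coboundaries of potentials *)

Section Potentials.
Variable G : multigraph.
Hypothesis hG : loopless G.
Implicit Types (c : seq (vertex G)) (e : arrows G) (C : subgraph G).

Lemma eq_is_direction C (e e' : arrows G) :
  {in C.2, e =1 e'} -> is_direction C e -> is_direction C e'.
Proof.
move=> ee' /andP[/forall_inP eo /forall_inP ed]; apply/andP; split.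
  by apply/forall_inP => x xC; rewrite -ee' // eo.
apply/forall_inP => v vC; have := ed v vC.
have -> : indegree C e v = indegree C e' v.
  by apply: eq_card => x; rewrite !inE; case: (boolP (x \in C.2)) => //= /ee' ->.
have -> // : outdegree C e v = outdegree C e' v.
by apply: eq_card => x; rewrite !inE; case: (boolP (x \in C.2)) => //= /ee' ->.
Qed.

Lemma circuit_edges_neq0 C : is_circuit C -> C.2 != set0.
Proof.
case/and3P=> _ /andP[/set0Pn[v vC] _] /forall_inP/(_ v vC).
apply: contraTneq => C0; rewrite /degree big_pred0 // => x.
by rewrite C0 inE.
Qed.

(** Passes from cyclic vertex sequences to circuits. Looplessness excludes length one, and
    injectivity of [g] makes a sequence of length two use two parallel edges. *)
Lemma circuit_of_cycle (c : seq (vertex G)) (g : vertex G -> edge G) :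
  uniq c -> c != [::] -> {in c &, injective g} ->
  (forall v, v \in c -> ends (g v) = [set v; next c v]) ->
  let C := ([set v in c], [set g v | v in c]) : subgraph G in
  is_circuit C /\
  forall e, (forall v, v \in c -> e (g v) = (v, next c v)) -> is_direction C e.
Proof.
move=> uc c0 gI gE C.
have nextN v : v \in c -> next c v != v.
  move=> vc; have := hG (g v); rewrite gE // cards2 eq_sym.
  by case: (next c v == v).
have prevc v : v \in c -> prev c v \in c by rewrite mem_prev.
split=> [|e eg].
  apply/and3P; split.
  - apply/forall_inP => x /imsetP[v vc ->]; rewrite gE //.
    by apply/subsetP => w; rewrite !inE => /orP[/eqP ->//|/eqP ->]; rewrite mem_next.
  - apply/andP; split.
      apply/set0Pn; case: c @C {uc gI gE nextN prevc} c0 => // v c' C _; exists v.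
      by rewrite inE mem_head.
    apply/forall_inP => u; rewrite inE => uc'; apply/forall_inP => v.
    rewrite inE => vc; apply: connect_cycle uc' vc.
    apply: (@sub_in_cycle _ (mem c) _ _ _ _ _ (cycle_next uc)); last exact: allss.
    move=> a b ac _ /eqP <-.
    by apply/existsP; exists (g a); rewrite gE // eqxx andbT; apply: imset_f.
  - apply/forall_inP => v; rewrite inE => vc.
    rewrite /degree (eq_bigr (fun=> 1%N)); last by move=> x _; rewrite hG.
    rewrite sum1dep_card.
    have -> : [set x in C.2 | v \in ends x] = [set g v; g (prev c v)].
      apply/setP => x; rewrite !inE; apply/andP/orP => [[/imsetP[w wc ->]]|].
        rewrite gE // !inE => /orP[/eqP ->|/eqP ->]; first by left.
        by right; rewrite prev_next.
      case=> /eqP ->; split; rewrite ?imset_f ?prevc // gE ?prevc // !inE ?eqxx //.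
      by rewrite next_prev // eqxx orbT.
    rewrite cards2 (inj_in_eq gI) ?prevc //.
    by have := nextN _ (prevc v vc); rewrite next_prev // => ->.
apply/andP; split.
  by apply/forall_inP => x /imsetP[v vc ->]; rewrite eg //= gE.
apply/forall_inP => v; rewrite inE => vc; rewrite /indegree /outdegree.
have -> : [set x in C.2 | (e x).2 == v] = [set g (prev c v)].
  apply/setP => x; rewrite !inE; apply/andP/eqP => [[/imsetP[w wc ->]]|->].
    by rewrite eg //= => /eqP <-; rewrite prev_next.
  by rewrite imset_f ?prevc // eg ?prevc //= next_prev.
have -> : [set x in C.2 | (e x).1 == v] = [set g v].
  apply/setP => x; rewrite !inE; apply/andP/eqP => [[/imsetP[w wc ->]]|->].
    by rewrite eg //= => /eqP <-.
  by rewrite imset_f // eg //=.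
by rewrite !cards1.
Qed.

Definition arc e : rel (vertex G) := fun v w => [exists x, e x == (v, w)].

(** An edge chosen along the cycle determines its tail, so the choice of edges is injective and
    yields a directed circuit. *)
Lemma acyclic_no_cycle e c :
  is_orientation (whole G) e -> acyclic e -> c != [::] -> uniq c ->
  ~~ cycle (arc e) c.
Proof.
move=> /forall_inP eo eA c0 uc; apply: contra eA => cyc.
have /fin_all_exists[g gP] v : exists x, v \in c -> e x = (v, next c v).
  case: (boolP (v \in c)) => [vc|_].
    by have /existsP[x /eqP ex] := next_cycle cyc vc; exists x.
  case: c c0 cyc {uc} => // w c' _ cyc.
  by have /existsP[x _] := next_cycle cyc (mem_head _ _); exists x.
have gI : {in c &, injective g}.
  by move=> v w vc wc gvw; have := gP v vc; rewrite gvw gP // => -[].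
have gE v : v \in c -> ends (g v) = [set v; next c v].
  by move=> vc; have := eo (g v); rewrite inE gP // => /(_ isT)/eqP <-.
have [Cc Cd] := circuit_of_cycle uc c0 gI gE.
apply/existsP; eexists; apply/andP; split; first exact: Cc.
exact: Cd.
Qed.

(** A vertex of [U] that reaches the fewest vertices is a sink: a successor in [U] would reach
    strictly fewer, since it cannot reach back. *)
Lemma acyclic_sinks e (U : {set vertex G}) :
  is_orientation (whole G) e -> acyclic e -> U != set0 ->
  sinks (arc e) U != set0.
Proof.
move=> eo eA /set0Pn[v0 v0U].
case: (@arg_minnP _ v0 (fun v => v \in U) (fun v => #|connect (arc e) v|) v0U).
move=> v vU vmin.
apply/set0Pn; exists v; rewrite !inE vU; apply/forall_inP => w wU.
apply/negP => vw.
have : ~~ connect (arc e) w v.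
  apply/negP => /connectP[p /shortenP[q wq uq _] vq].
  have := acyclic_no_cycle eo eA (c := w :: q) isT uq.
  by rewrite /= rcons_path wq -vq vw.
apply/negP/negPn; have := vmin w wU; apply: contraLR => wv; rewrite -ltnNge.
apply: proper_card; apply/properP; split.
  by apply/subsetP => u; apply: connect_trans; apply: connect1.
by exists v; [exact: connect0|].
Qed.

Section Tensions.
Variables (A : zmodType) (e : arrows G).
Hypothesis eo : is_orientation (whole G) e.

Definition potential_difference (p : vertex G -> A) : {ffun edge G -> A} :=
  [ffun x => p (e x).2 - p (e x).1].

(** An edge with two ends carries only two arrows, so a coupling of -1 means that [e] and [eC] are
    opposite there, and it compensates the sign. *)
Lemma potential_difference_coupling (p : vertex G -> A) C (eC : arrows G) (x : edge G) :
  is_direction C eC -> x \in C.2 ->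
  potential_difference p x *~ coupling (whole G) e C eC x
    = p (eC x).2 - p (eC x).1.
Proof.
move=> /andP[/forall_inP/(_ x) + _] xC; move=> /(_ xC) /eqP eCx.
have := forall_inP eo x (in_setT _); rewrite -eCx ffunE /coupling inE xC /=.
have := hG x; rewrite -eCx; case: (e x) (eC x) => [a b] [a' b'] /=.
rewrite xpair_eqE cards2; case: eqVneq => //= ab' _ /eqP/setP E.
have := E a'; have := E b'; have := E a; rewrite !inE !eqxx orbT /=.
case: (eqVneq a a') => [->|aa'] /=.
  rewrite eq_sym (negbTE ab') /= => _ /eqP <- _.
  by rewrite eqxx.
move=> /esym/eqP <- _ /eqP ->.
by rewrite mulrNz mulr1z opprB.
Qed.

(** Around a directed circuit every vertex is once a head and once a tail, so the sum cancels. *)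
Lemma potential_difference_is_tension (p : vertex G -> A) :
  is_tension e (potential_difference p).
Proof.
move=> C eC Cc Cd; have /and3P[/forall_inP sub _ _] := Cc.
have /andP[/forall_inP eCo /forall_inP eCd] := Cd.
rewrite (eq_bigr _ (fun x xC => potential_difference_coupling p Cd xC)).
have sub1 x : x \in C.2 -> (eC x).1 \in C.1.
  by move=> xC; apply: (subsetP (sub x xC)); rewrite -(eqP (eCo x xC)) !inE eqxx.
have sub2 x : x \in C.2 -> (eC x).2 \in C.1.
  by move=> xC; apply: (subsetP (sub x xC)); rewrite -(eqP (eCo x xC)) !inE eqxx orbT.
rewrite sumrB; apply/eqP; rewrite subr_eq0; apply/eqP.
rewrite [LHS](partition_big _ _ sub2) [RHS](partition_big _ _ sub1) /=.
apply: eq_bigr => v vC.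
rewrite (eq_bigr (fun=> p v)) => [|x /andP[_ /eqP ->] //].
rewrite [RHS](eq_bigr (fun=> p v)) => [|x /andP[_ /eqP ->] //].
rewrite !sumr_const; have /andP[/eqP i1 /eqP o1] := eCd v vC.
have -> : #|[pred x in C.2 | (eC x).2 == v]| = 1%N.
  by rewrite -[RHS]i1; apply: eq_card => x; rewrite !inE.
have -> : #|[pred x in C.2 | (eC x).1 == v]| = 1%N.
  by rewrite -[RHS]o1; apply: eq_card => x; rewrite !inE.
by [].
Qed.

Lemma tension_sub (f f' : {ffun edge G -> A}) :
  is_tension e f -> is_tension e f' -> is_tension e [ffun x => f x - f' x].
Proof.
move=> ft f't C eC Cc Cd; under eq_bigr do rewrite ffunE mulrzBl.
by rewrite sumrB ft // f't // subrr.
Qed.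

Lemma adjacent_sym (F : {set edge G}) : symmetric (adjacent F).
Proof. by move=> u v; apply: eq_existsb => x; rewrite setUC. Qed.

(* Adding one edge x at a time: if F already joins the ends of x, closing a
   path of F by x gives a circuit on which f - dp is supported on x alone. *)
Lemma tension_potential (f : {ffun edge G -> A}) :
  is_tension e f -> exists p, f = potential_difference p.
Proof.
move=> ft.
suff [p fp] : exists p, {in enum (edge G), f =1 potential_difference p}.
  by exists p; apply/ffunP => x; apply: fp; rewrite mem_enum.
elim: (enum _) => [|x s [p fp]]; first by exists (fun=> 0).
case: (boolP (x \in s)) => xs.
  by exists p => y; rewrite inE => /orP[/eqP ->|]; exact: fp.
set u := (e x).1; set v := (e x).2; set F := [set y in s].
have uv : [set u; v] = ends x by apply/eqP; exact: (forall_inP eo x (in_setT _)).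
case: (boolP (connect (adjacent F) v u)) => [|nvu]; last first.
  (* The ends of [x] lie in different components of [F], so shifting [p] by a constant on the
     component of [v] corrects the value at [x] and changes nothing on the edges of [s]. *)
  exists (fun w => p w + if connect (adjacent F) v w
                         then f x - potential_difference p x else 0).
  move=> y; rewrite inE => /orP[/eqP ->|ys].
    by rewrite ffunE -/u -/v connect0 (negbTE nvu) addr0 ffunE addrAC addrC subrK.
  have yF : adjacent F (e y).1 (e y).2.
    apply/existsP; exists y; rewrite inE ys /= eq_sym.
    exact: (forall_inP eo y (in_setT _)).
  rewrite fp // !ffunE.
  have -> : connect (adjacent F) v (e y).2 = connect (adjacent F) v (e y).1.
    exact/esym/(same_connect1r (sym_connect_sym (adjacent_sym F)) yF).
  by rewrite [p (e y).1 + _]addrC addrKA.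
case/connectP => _ /shortenP[q vq uq _] uE.
(* The second disjunct is the closing step along [x], from [u] back to [v]. *)
have cyc : cycle (fun a b => adjacent F a b || (a == u) && (b == v)) (v :: q).
  rewrite /= rcons_path -uE !eqxx orbT andbT.
  by apply: sub_path vq => a b ->.
set c := v :: q; have uc : u \in c by rewrite uE mem_last.
have nextu : next c u = v.
  by have := cycle_next uq; rewrite /= rcons_path -uE => /andP[_ /eqP].
have indexS w : w \in c -> w != u -> index (next c w) c = (index w c).+1.
  move=> wc wu; have iw : (index w c < size q)%N.
    have : (index w c <= size q)%N by rewrite -ltnS -/(size c) index_mem.
    rewrite leq_eqVlt => /orP[/eqP iq|//]; have := nth_index v wc.
    rewrite iq (_ : size q = (size c).-1) // nth_last [last _ _]/= -uE => wE.
    by rewrite wE eqxx in wu.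
  rewrite next_nth wc; exact: (@index_uniq _ v (index w c).+1 c).
have xw w : w \in c -> (w == u) = false -> adjacent F w (next c w).
  move=> wc wu; have := next_cycle cyc wc; rewrite wu /= orbF.
  by [].
have /fin_all_exists[g gP] w : exists y, w \in c ->
    ends y = [set w; next c w] /\ (if w == u then y = x else y \in s).
  case: (boolP (w \in c)) => wc; last by exists x.
  case: eqP => [->|/eqP/negbTE wu]; first by exists x; rewrite nextu -uv.
  have /existsP[y] := xw w wc wu; rewrite inE => /andP[ys /eqP yE].
  by exists y.
have gE w : w \in c -> ends (g w) = [set w; next c w] by move=> /gP[].
have gI : {in c &, injective g}.
  move=> w w' wc w'c gw; have [_] := gP w wc; have [_] := gP w' w'c.
  rewrite -gw; case: eqP => [->|/eqP w'u] => [->|gs].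
    by case: eqP => // _; rewrite (negbTE xs).
  case: eqP => [_ gx|/eqP wu _]; first by rewrite -gx gs in xs.
  (* Two distinct vertices sharing an edge would be each other's successors, but the index in [c]
     rises by one after every vertex other than [u]. *)
  have /setP E : [set w; next c w] = [set w'; next c w'] by rewrite -!gE // gw.
  apply/eqP; apply: contraT => ww'; have := E w; have := E w'.
  rewrite !inE !eqxx (eq_sym w') (negbTE ww') !(orFb, orTb) => /eqP w'E /esym/eqP wE.
  have := indexS w wc wu; rewrite -w'E => i1.
  have := indexS w' w'c w'u; rewrite -wE i1 => /eqP.
  by rewrite ltn_eqF.
have [Cc Cd] := circuit_of_cycle uq isT gI gE.
have /fin_all_exists[h hP] y : exists a, forall w, w \in c -> g w = y -> a = (w, next c w).
  case: (boolP [exists w in c, g w == y]) => [/exists_inP[w wc /eqP <-]|nw].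
    by exists (w, next c w) => w' w'c /gI ->.
  exists (u, v) => w wc gw; case/negP: nw; apply/exists_inP.
  by exists w; rewrite ?gw.
have Cd' := Cd (finfun h) (fun w wc => etrans (ffunE _ _) (hP _ w wc erefl)).
have xC : x \in [set g w | w in c].
  by apply/imsetP; exists u => //; have [_] := gP u uc; rewrite eqxx.
have := tension_sub ft (potential_difference_is_tension p) Cc Cd'.
rewrite (bigD1 x) //= big1 ?addr0 => [|y /andP[/imsetP[w wc yE] yx]]; last first.
  have [_] := gP w wc; rewrite -yE; case: eqP => [_ yx'|_ ys].
    by rewrite yx' eqxx in yx.
  by rewrite ffunE fp // subrr mul0rz.
rewrite ffunE /coupling inE xC /= => fpx.
have {}fpx : f x = potential_difference p x.
  apply/eqP; rewrite -subr_eq0; move: fpx; case: ifP => _.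
    by rewrite mulr1z => ->.
  by rewrite mulrNz mulr1z => /eqP; rewrite oppr_eq0.
by exists p => y; rewrite inE => /orP[/eqP ->|/fp].
Qed.

End Tensions.

End Potentials.

(** * Reorientation along edge sets, and acyclicity *)

Section Reorientation.
Variable G : multigraph.
Hypothesis hG : loopless G.
Implicit Types (e : arrows G) (A : {set edge G}).

Definition reorient e A : arrows G :=
  [ffun x => if x \in A then ((e x).2, (e x).1) else e x].

Lemma reorient_orientation e A :
  is_orientation (whole G) e -> is_orientation (whole G) (reorient e A).
Proof.
move=> /forall_inP eo; apply/forall_inP => x /eo /eqP <-; rewrite ffunE.
by case: ifP => _ //=; rewrite setUC.
Qed.

Lemma reorientK A : involutive (reorient^~ A).
Proof.
move=> e; apply/ffunP => x; rewrite !ffunE.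
by case: (x \in A) => //=; case: (e x).
Qed.

Definition sign_flip (R : zmodType) A (f : {ffun edge G -> R}) :
    {ffun edge G -> R} := [ffun x => if x \in A then - f x else f x].

Lemma sign_flipK (R : zmodType) A : involutive (@sign_flip R A).
Proof.
by move=> f; apply/ffunP => x; rewrite !ffunE; case: (x \in A); rewrite ?opprK.
Qed.

Lemma potential_difference_reorient (R : zmodType) e A (p : vertex G -> R) :
  potential_difference (reorient e A) p = sign_flip A (potential_difference e p).
Proof.
apply/ffunP => x; rewrite !ffunE; case: ifP => // _.
by rewrite opprB.
Qed.

Lemma tension_reorient (R : zmodType) e A (f : {ffun edge G -> R}) :
  is_orientation (whole G) e ->
  is_tension e f -> is_tension (reorient e A) (sign_flip A f).
Proof.
move=> eo /(tension_potential hG eo)[p ->].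
rewrite -potential_difference_reorient.
exact/potential_difference_is_tension/reorient_orientation.
Qed.

Lemma tension_sum_directed_circuit (R : zmodType) e (f : {ffun edge G -> R}) C :
  is_tension e f -> is_circuit C -> is_direction C e ->
  \sum_(x in C.2) f x = 0.
Proof.
move=> ft Cc Cd; rewrite -[RHS](ft C e Cc Cd); apply: eq_bigr => x xC.
by rewrite /coupling inE xC eqxx mulr1z.
Qed.

(** The values around a directed circuit would be positive and sum to zero. *)
Lemma positive_tension_acyclic e (f : {ffun edge G -> int}) :
  is_tension e f -> (forall x, 0 < f x) -> acyclic e.
Proof.
move=> ft f0; apply/existsP => -[C /andP[Cc Cd]].
have /set0Pn[x xC] := circuit_edges_neq0 Cc.
have := tension_sum_directed_circuit ft Cc Cd.
rewrite (bigD1 x) //= => /eqP; apply/negP; rewrite gt_eqF //.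
by apply: ltr_pwDl => //; apply: sumr_ge0 => y _; apply: ltW.
Qed.

Definition indicator A : {ffun edge G -> int} := [ffun x => (x \in A)%:R].

(** On a circuit directed by the reorientation, the flipped indicator equals -1_A and sums to zero.
    So the circuit misses [A] and is already directed by [e]. *)
Lemma reorient_cut_acyclic e A :
  is_orientation (whole G) e -> acyclic e -> is_tension e (indicator A) ->
  acyclic (reorient e A).
Proof.
move=> eo eA At; apply/existsP => -[C /andP[Cc Cd]].
have At' := @tension_reorient _ e A _ eo At.
have := tension_sum_directed_circuit At' Cc Cd.
move/(congr1 -%R); rewrite oppr0 -sumrN => /eqP.
have fE x : - sign_flip A (indicator A) x = (x \in A)%:R.
  by rewrite !ffunE; case: (x \in A); rewrite ?opprK ?oppr0.
rewrite (eq_bigr _ (fun x _ => fE x)) psumr_eq0 // => /allP CA.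
move/existsP: eA; apply; exists C; rewrite Cc; apply: eq_is_direction Cd.
move=> x xC; rewrite ffunE; have := CA x (mem_index_enum _).
by rewrite xC /= pnatr_eq0 eqb0 => /negbTE ->.
Qed.

(** Orienting each edge towards the larger enumeration rank makes the rank a potential with positive
    differences. Nonemptiness is what keeps the summed polynomials from vanishing. *)
Lemma acyclic_orientation_exists : acyclic_orientations G != set0.
Proof.
have /fin_all_exists[h hP] x : exists a : vertex G * vertex G,
    [set a.1; a.2] = ends x /\ (enum_rank a.1 < enum_rank a.2)%N.
  have /eqP/cards2P[u [v [uv xE]]] := hG x; rewrite xE.
  have : enum_rank u != enum_rank v :> nat by rewrite (inj_eq val_inj) (inj_eq enum_rank_inj).
  rewrite neq_ltn => /orP[lt|lt]; first by exists (u, v).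
  by exists (v, u); split=> //=; rewrite setUC.
have eo : is_orientation (whole G) (finfun h).
  by apply/forall_inP => x _; rewrite ffunE; have [/eqP] := hP x.
apply/set0Pn; exists (finfun h); rewrite inE eo /=.
apply: (@positive_tension_acyclic _ (potential_difference (finfun h) (fun v => (enum_rank v)%:Z))).
  exact: potential_difference_is_tension.
move=> x; rewrite !ffunE subr_gt0 ltz_nat; by have [] := hP x.
Qed.

End Reorientation.

(** * Division of potentials by q: cuts and remainders *)

Section Decomposition.
Variable G : multigraph.
Hypothesis hG : loopless G.

(** One representative per component, at which potentials are normalised. *)
Definition base_points : {set vertex G} :=
  [set v | v \in roots (adjacent [set: edge G])].

Definition base_point : vertex G -> vertex G :=
  fingraph.root (adjacent [set: edge G]).

Lemma card_base_points : #|base_points| = components G.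
Proof. by apply: eq_card => v; rewrite !inE andbT. Qed.

Lemma connect_adjacent_sym : connect_sym (adjacent [set: edge G]).
Proof. exact/sym_connect_sym/adjacent_sym. Qed.

Lemma base_point_in v : base_point v \in base_points.
Proof. by rewrite in_set; exact/roots_root/connect_adjacent_sym. Qed.

Lemma base_point_id v : v \in base_points -> base_point v = v.
Proof. by rewrite inE => /eqP. Qed.

Section Orientation.
Variable e : arrows G.
Hypothesis eo : is_orientation (whole G) e.

Lemma arrow_adjacent x : adjacent [set: edge G] (e x).1 (e x).2.
Proof.
apply/existsP; exists x; rewrite in_setT /= eq_sym.
exact: (forall_inP eo x (in_setT _)).
Qed.

Lemma base_point_arrow x : base_point (e x).1 = base_point (e x).2.
Proof.
apply/eqP; rewrite /base_point (root_connect connect_adjacent_sym).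
exact/connect1/arrow_adjacent.
Qed.

(** A potential may be shifted by a constant on each component without changing its differences. *)
Lemma normalised_potential (f : {ffun edge G -> int}) (r : vertex G -> int) :
  is_tension e f ->
  exists2 p, f = potential_difference e p & {in base_points, p =1 r}.
Proof.
move=> /(tension_potential hG eo)[p ->].
exists (fun v => p v - p (base_point v) + r (base_point v)).
  apply/ffunP => x; rewrite !ffunE base_point_arrow; lia.
by move=> v vB; rewrite base_point_id // subrr add0r.
Qed.

(** The vertices where [p] and [p'] agree form a union of components and include every base
    point. *)
Lemma potential_difference_inj (p p' : vertex G -> int) :
  potential_difference e p = potential_difference e p' ->
  {in base_points, p =1 p'} -> p =1 p'.
Proof.
move=> /ffunP E pp' v; pose d w := p w == p' w.
have : closed (adjacent [set: edge G]) d.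
  move=> u w /existsP[x /andP[_ /eqP xE]].
  have := E x; rewrite !ffunE /in_mem /= /d => Ex.
  have := forall_inP eo x (in_setT _); rewrite xE => /eqP/setP uw.
  have : ((e x).1 = u /\ (e x).2 = w) \/ ((e x).1 = w /\ (e x).2 = u).
    have /set2P[a1|a1] : (e x).1 \in [set u; w] by rewrite -uw !inE eqxx.
      have := uw w; rewrite !inE eqxx a1 orbT => /orP[/eqP wu|/eqP]; last by left.
      have := uw (e x).2; rewrite !inE eqxx orbT wu orbb => /esym/eqP ->.
      by left.
    have := uw u; rewrite !inE eqxx a1 => /orP[/eqP uw'|/eqP]; last by right.
    have := uw (e x).2; rewrite !inE eqxx orbT uw' orbb => /esym/eqP ->.
    by left.
  by case=> -[Eu Ew]; move: Ex; rewrite Eu Ew => Ex; apply/eqP/eqP; lia.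
move/closed_connect/(_ (base_point v) v).
rewrite connect_adjacent_sym connect_root => /(_ isT).
by rewrite /in_mem /= /d pp' ?base_point_in // eqxx => /esym/eqP.
Qed.

(** The 0/1 tensions, that is, the vertices of the closed polytope, recorded by their supports. *)
Definition cuts : {set {set edge G}} :=
  [set A | `[< is_tension e (indicator A) >]].

Lemma monotone_arcP (strict : bool) (M : nat) (A : {set edge G})
    (b : {ffun vertex G -> 'I_M.+1}) :
  reflect (forall x, let a := reorient e A x in
             (if strict then b a.1 < b a.2 else b a.1 <= b a.2)%N)
    (b \in monotone_maps (arc (reorient e A)) strict M [set: vertex G] M.+1).
Proof.
apply: (iffP (monotone_mapsP _ _ _ _ _)) => [[_ _ bD] x /=|bD].
  apply: bD; rewrite ?in_setT //; apply/existsP; exists x.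
  by rewrite -surjective_pairing.
split=> [v _|v|v w _ _ /existsP[x /eqP xE]]; rewrite ?in_setT //.
by have := bD x; rewrite xE.
Qed.

Definition within (strict : bool) (q : nat) (f : {ffun edge G -> int}) : Prop :=
  forall x, if strict then 0 < f x < q%:Z else 0 <= f x <= q%:Z.

(** The pairs (A, b) for q = [M.+1]. Prescribing b = [r] at the base points removes the freedom in
    the choice of a potential. *)
Definition residues (strict : bool) (M : nat) (r : {ffun vertex G -> 'I_M.+1}) :
    {set {set edge G} * {ffun vertex G -> 'I_M.+1}} :=
  [set z | [&& z.1 \in cuts,
      z.2 \in monotone_maps (arc (reorient e z.1)) strict M [set: vertex G] M.+1
    & [forall v in base_points, z.2 v == r v]]].

Definition assemble (M : nat) (z : {set edge G} * {ffun vertex G -> 'I_M.+1}) :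
    {ffun edge G -> int} :=
  [ffun x => M.+1%:Z * indicator z.1 x
             + potential_difference e (fun v => (z.2 v)%:Z) x].

(** The potential q a + b is determined by its differences and base values; division by q then
    recovers a, hence A, and b. *)
Lemma assemble_inj (strict : bool) (M : nat) (r : {ffun vertex G -> 'I_M.+1}) :
  {in residues strict r &, injective (@assemble M)}.
Proof.
move=> [A b] [A' b']; rewrite !inE /=.
move=> /and3P[/asboolP At _ /forall_inP br] /and3P[/asboolP At' _ /forall_inP br'].
have [a aE a0] := normalised_potential (fun=> 0) At.
have [a' aE' a0'] := normalised_potential (fun=> 0) At'.
move=> /ffunP E.
have pE : (fun v => M.+1%:Z * a v + (b v)%:Z) =1 (fun v => M.+1%:Z * a' v + (b' v)%:Z).
  apply: potential_difference_inj => [|v vB].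
    apply/ffunP => x; have /ffunP/(_ x) := aE; have /ffunP/(_ x) := aE'.
    by have := E x; rewrite !ffunE /=; lia.
  by rewrite /= a0 // a0' // (eqP (br v vB)) (eqP (br' v vB)).
have bb v : b v = b' v /\ a v = a' v.
  have := pE v; have := ltn_ord (b v); have := ltn_ord (b' v) => b1 b2 E'.
  have aa : a v = a' v by nia.
  split=> //; apply: val_inj => /=; by move: E'; rewrite aa => /addrI[].
congr (_, _); last by apply/ffunP => v; have [] := bb v.
apply/setP => x; apply/idP/idP => xA; apply: contraT => /negbTE xA'.
  have /ffunP/(_ x) := aE; have /ffunP/(_ x) := aE'; rewrite !ffunE xA xA'.
  by rewrite !(proj2 (bb _)) => <-.
have /ffunP/(_ x) := aE; have /ffunP/(_ x) := aE'; rewrite !ffunE xA xA'.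
by rewrite !(proj2 (bb _)) => <-.
Qed.

(** Write a potential as q a + b with 0 <= b < q. Since db lies strictly between -q and q, the
    bounds on q da + db force da to be 0 or 1, and then amount to monotonicity of b along the
    reoriented arrows. *)
Lemma assemble_image (strict : bool) (M : nat) (r : {ffun vertex G -> 'I_M.+1})
    (f : {ffun edge G -> int}) :
  is_tension e f /\ within strict M.+1 f <->
  exists2 z, z \in residues strict r & assemble z = f.
Proof.
split=> [[ft fq]|[[A b]]].
  (* Base values [r v] below q are their own remainders, so b will agree with [r] there. *)
  have [p fE pr] := normalised_potential (fun v => (r v)%:Z) ft.
  pose a v := (p v %/ M.+1%:Z)%Z.
  have bP v : exists i : 'I_M.+1, (p v %% M.+1%:Z)%Z = i%:Z.
    have := ltz_pmod (p v) (isT : 0 < M.+1%:Z); have := modz_ge0 (p v) (isT : M.+1%:Z != 0).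
    by case: (p v %% _)%Z => // i _ iM; exists (Ordinal (iM : (i < M.+1)%N)).
  have [b bE] := fin_all_exists bP.
  have pE v : p v = a v * M.+1%:Z + (b v)%:Z by rewrite -bE; exact: divz_eq.
  pose A := [set x | potential_difference e a x == 1].
  have AE : indicator A = potential_difference e a.
    apply/ffunP => x; rewrite !ffunE inE ffunE.
    have := fq x; rewrite fE ffunE !pE.
    have := ltn_ord (b (e x).1); have := ltn_ord (b (e x).2).
    case: eqP; case: (strict) => /=; nia.
  exists (A, finfun b); last first.
    apply/ffunP => x; have /ffunP/(_ x) := AE; rewrite fE !ffunE !pE /=; lia.
  rewrite inE /=; apply/and3P; split.
  - rewrite inE; apply/asboolP; rewrite AE.
    exact: potential_difference_is_tension.
  - apply/monotone_arcP => x /=; rewrite !ffunE.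
    have := fq x; have /ffunP/(_ x) := AE; rewrite fE !ffunE !pE.
    have := ltn_ord (b (e x).1); have := ltn_ord (b (e x).2).
    by case: (x \in A); case: (strict) => /=; nia.
  - apply/forall_inP => v vB; apply/eqP; apply: val_inj; rewrite /= ffunE.
    by have := bE v; rewrite pr // modz_small ?ltz_nat ?ltn_ord // => -[].
rewrite inE /= => /and3P[]; rewrite inE => /asboolP At /monotone_arcP bD br <-.
split.
  have [a aE _] := normalised_potential (fun=> 0) At.
  have -> : assemble (A, b) = potential_difference e (fun v => M.+1%:Z * a v + (b v)%:Z).
    apply/ffunP => x; have /ffunP/(_ x) := aE; rewrite !ffunE /=; lia.
  exact: potential_difference_is_tension.
move=> x; have := bD x; rewrite /= !ffunE /=.
have := ltn_ord (b (e x).1); have := ltn_ord (b (e x).2).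
case: (x \in A) => /=; case: (strict) => /=; lia.
Qed.

End Orientation.

End Decomposition.

(** * Auxiliary facts on counting, polynomials and alternating sums *)

Lemma count_image (F : finType) (T : choiceType) (A : {set F}) (h : F -> T)
    (S : classical_sets.set T) :
  {in A &, injective h} ->
  (forall t, S t <-> exists2 z, z \in A & h z = t) -> Defs.count S = #|A|.
Proof.
move=> hI hS; rewrite /Defs.count.
have -> : S = [set` [fset h z | z in A]%fset]%classic.
  apply/classical_sets.seteqP; split=> t /=.
    by move=> /hS[z zA <-]; apply/imfsetP; exists z.
  by move=> /imfsetP[z /= zA ->]; apply/hS; exists z.
by rewrite set_fsetK card_in_imfset //= -cardE.
Qed.

Lemma poly_eq_at_positive_nat (R : numFieldType) (p p' : {poly R}) :
  (forall q : nat, (0 < q)%N -> p.[q%:R] = p'.[q%:R]) -> p = p'.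
Proof.
move=> pp'; apply/eqP; rewrite -subr_eq0; apply/eqP.
apply: (@roots_geq_poly_eq0 _ _ [seq n.+1%:R | n <- iota 0 (size (p - p'))]).
- apply/allP => _ /mapP[n _ ->]; apply/rootP.
  by rewrite hornerD hornerN pp' // subrr.
- by rewrite map_inj_uniq ?iota_uniq // => m n /eqP; rewrite eqr_nat => /eqP[].
- by rewrite size_map size_iota.
Qed.

(** Translation preserves degree and leading coefficient; [n] may exceed the degree, and then both
    coefficients vanish. *)
Lemma coef_comp_XsubC (R : idomainType) (p : {poly R}) (c : R) (n : nat) :
  (size p <= n.+1)%N -> (p \Po ('X - c%:P))`_n = p`_n.
Proof.
move=> szp; have sz : size (p \Po ('X - c%:P)) = size p.
  by rewrite size_comp_poly2 // size_XsubC.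
have [szn|] := leqP (size p) n.
  by rewrite !nth_default ?sz.
move=> np; have szE : size p = n.+1 by apply/eqP; rewrite eqn_leq szp.
have := lead_coef_comp p (q := 'X - c%:P); rewrite size_XsubC => /(_ isT).
by rewrite lead_coefXsubC expr1n mulr1 /lead_coef sz szE.
Qed.

(** Substituting J = K \ I turns this into a sum over subsets I of K \ B, where [#|~: J|] is
    [#|~: K|] plus [#|I|]. *)
Lemma sum_sign_between (R : comNzRingType) (T : finType) (B K : {set T}) :
  \sum_(J : {set T} | (B \subset J) && (J \subset K)) (-1) ^+ #|~: J|
  = (-1) ^+ #|~: B| * (B == K)%:R :> R.
Proof.
case: (boolP (B \subset K)) => BK; last first.
  rewrite big_pred0 => [|J]; first by case: eqP BK => [->|_]; rewrite ?subxx ?mulr0.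
  by apply/negP => /andP[BJ /(subset_trans BJ)]; apply/negP.
rewrite (reindex_onto (fun I => K :\: I) (fun J => K :\: J)) /=; last first.
  by move=> J /andP[_ /setIidPr JK]; rewrite setDDr setDv set0U.
rewrite (eq_bigl (fun I : {set T} => I \subset K :\: B)) => [|I]; last first.
  rewrite subsetDl andbT setDDr setDv set0U (sameP eqP setIidPr).
  rewrite !subsetD BK /= andbC; congr andb.
  by rewrite disjoint_sym.
have -> : (B == K) = (K :\: B == set0) by rewrite setD_eq0 eqEsubset BK.
rewrite (eq_bigr (fun I : {set T} => (-1) ^+ #|~: K| * (-1) ^+ #|I|)) => [|I IKB].
  rewrite -mulr_sumr sum_sign_subset; case: (eqVneq (K :\: B) set0) => [KB|_].
    suff -> : K = B by [].
    by apply/eqP; rewrite eqEsubset BK -setD_eq0 KB eqxx.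
  by rewrite !mulr0.
have /setIidPr IK : I \subset K by move: IKB; rewrite subsetD => /andP[].
rewrite -exprD; congr (_ ^+ _); rewrite setCD cardsU -{2}IK.
by rewrite setIA [~: K :&: K]setIC setICr set0I cards0 subn0.
Qed.

(** * The counting polynomial of a single acyclic orientation *)

Section OrientationPolynomial.
Variables (R : numFieldType) (G : multigraph).
Hypothesis hG : loopless G.
Local Notation base_points := (base_points G).

Section Counting.
Variable e : arrows G.
Hypothesis eo : is_orientation (whole G) e.

Definition tension_count (strict : bool) (q : nat) : nat :=
  Defs.count [set f : {ffun edge G -> int} | is_tension e f /\ within strict q f]%classic.

(** The count is independent of [r], so the base values are free to choose: below they are summed
    over, set to the maximum, or set to zero. *)
Lemma card_residues (strict : bool) (M : nat) (r : {ffun vertex G -> 'I_M.+1}) :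
  #|residues e strict r| = tension_count strict M.+1.
Proof.
apply/esym/(count_image (h := @assemble _ e M)); first exact: assemble_inj.
by move=> f; exact: assemble_image.
Qed.

(** Sorting the pairs (A, b) by the values of b at the base points gives classes of equal size, one
    for each choice of base values. *)
Lemma sum_card_monotone_maps (strict : bool) (M : nat) :
  (\sum_(A in cuts e)
     #|monotone_maps (arc (reorient e A)) strict M [set: vertex G] M.+1|
   = M.+1 ^ components G * tension_count strict M.+1)%N.
Proof.
pose Z := [set z : {set edge G} * {ffun vertex G -> 'I_M.+1} | (z.1 \in cuts e) &&
  (z.2 \in monotone_maps (arc (reorient e z.1)) strict M [set: vertex G] M.+1)].
transitivity #|Z|.
  rewrite -sum1_card (eq_bigr _ (fun A _ => esym (sum1_card _))).
  rewrite pair_big_dep /=; apply: eq_bigl => z; by rewrite [in RHS]inE.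
pose rest (z : {set edge G} * {ffun vertex G -> 'I_M.+1}) : {ffun vertex G -> 'I_M.+1} :=
  [ffun v => if v \in base_points then z.2 v else ord0].
rewrite -sum1_card (partition_big rest (mem (pffun_on ord0 (mem base_points) (mem 'I_M.+1)))) /=.
  have <- : #|pffun_on (ord0 : 'I_M.+1) (mem base_points) (mem 'I_M.+1)| = (M.+1 ^ components G)%N.
    by rewrite card_pffun_on card_ord card_base_points.
  rewrite -sum_nat_const.
  apply: eq_bigr => r /pffun_onP[/supportP r0 _]; rewrite -(card_residues strict r) -sum1_card.
  apply: eq_bigl => z; rewrite /Z !in_set -andbA; congr [&& _, _ & _].
  apply/eqP/forall_inP => [<- v vB|zr]; first by rewrite ffunE vB.
  apply/ffunP => v; rewrite ffunE; case: ifPn => vB; first exact/eqP/zr.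
  by rewrite r0.
move=> z _; apply/pffun_onP; split=> //.
by apply/supportP => v vB; rewrite ffunE (negbTE vB).
Qed.

(** The base points are put at the top value [M], and [J] is the full top level, a set of sinks by
    strictness. Each summand is an order polynomial evaluated at M = q - 1, which shows
    polynomiality in q without dividing by q^k(G). *)
Lemma tension_count_strict (M : nat) :
  tension_count true M.+1 =
  (\sum_(A in cuts e)
     \sum_(J : {set vertex G} | (base_points \subset J) &&
          (J \subset sinks (arc (reorient e A)) setT))
       #|monotone_maps (arc (reorient e A)) true M (~: J) M|)%N.
Proof.
rewrite -(card_residues true [ffun=> ord_max]).
pose L A (J : {set vertex G}) :=
  [set b in monotone_maps (arc (reorient e A)) true M setT M.+1 |
     [forall v in [set: vertex G], if v \in J then b v == M :> nat else (b v < M)%N]].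
transitivity (\sum_(A in cuts e)
   \sum_(J : {set vertex G} | (base_points \subset J) &&
          (J \subset sinks (arc (reorient e A)) setT)) #|L A J|)%N; last first.
  apply: eq_bigr => A _; apply: eq_bigr => J /andP[_ Js].
  by rewrite -setTD; apply: card_peel => //=.
transitivity (\sum_(A in cuts e)
  #|[set b in monotone_maps (arc (reorient e A)) true M setT M.+1 |
      [forall v in base_points, b v == ord_max]]|)%N.
  rewrite -sum1_card [RHS](eq_bigr _ (fun A _ => esym (sum1_card _))).
  rewrite pair_big_dep /=; apply: eq_bigl => -[A b]; rewrite !in_set /=.
  congr [&& _, _ & _]; by apply: eq_forallb => v; rewrite ffunE.
apply: eq_bigr => A _; rewrite -sum1_card.
pose top (b : {ffun vertex G -> 'I_M.+1}) := [set v | b v == M :> nat].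
rewrite (partition_big top (fun J => (base_points \subset J) &&
          (J \subset sinks (arc (reorient e A)) setT))) /=.
  apply: eq_bigr => J /andP[BJ _]; rewrite -sum1_card; apply: eq_bigl => b.
  rewrite [in RHS]in_set [in LHS]in_set.
  case: (boolP (b \in _)) => //= /monotone_mapsP[bM _ _].
  apply/andP/forall_inP => [[_ /eqP <-] v _|bJ].
    rewrite inE; case: ifPn => // bv; rewrite ltn_neqAle bv.
    by rewrite -ltnS bM.
  have topJ : top b = J.
    apply/setP => v; rewrite inE; have := bJ v (in_setT v).
    by case: ifP => // _; apply: ltn_eqF.
  split; last by rewrite topJ.
  apply/forall_inP => v vB; have := bJ v (in_setT v).
  by rewrite (subsetP BJ) // => /eqP bv; apply/eqP/val_inj.
move=> b; rewrite in_set => /andP[/monotone_mapsP[_ _ bD] /forall_inP bB].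
apply/andP; split.
  by apply/subsetP => v /bB/eqP bv; rewrite inE bv.
apply/subsetP => v; rewrite !inE => /eqP bv; apply/forall_inP => w _.
apply/negP => vw; have := bD v w (in_setT v) (in_setT w) vw.
by rewrite bv ltnNge -ltnS ltn_ord.
Qed.

(* The reorientation along a cut A whose potential has maximal sum: pushing a
   sink outside the base points up by one would increase that sum. *)
Lemma cut_sinks_base_points_exists :
  acyclic e ->
  exists2 A, A \in cuts e & sinks (arc (reorient e A)) setT = base_points.
Proof.
move=> eA.
have potP (A : {set edge G}) : exists p : vertex G -> int, A \in cuts e ->
    indicator A = potential_difference e p /\ {in base_points, p =1 fun=> 0}.
  case: (boolP (A \in cuts e)) => [|_]; last by exists (fun=> 0).
  rewrite inE => /asboolP At; have [p pE p0] := normalised_potential hG eo (fun=> 0) At.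
  by exists p.
have [a aP] := fin_all_exists potP.
have cut0 : set0 \in cuts e.
  rewrite inE; apply/asboolP.
  have -> : indicator set0 = potential_difference e (fun=> 0 : int).
    by apply/ffunP => x; rewrite !ffunE inE subrr.
  exact: potential_difference_is_tension.
case: (@arg_maxP _ _ _ set0 (fun A => A \in cuts e) (fun A => \sum_v a A v) cut0).
move=> A Acut Amax; exists A => //; have [aE a0] := aP A Acut.
have AaP x : (x \in A)%:R = a A (e x).2 - a A (e x).1 :> int.
  by have /ffunP/(_ x) := aE; rewrite !ffunE.
have sinkB v : v \in sinks (arc (reorient e A)) setT -> v \in base_points.
  rewrite inE => /andP[_ /forall_inP vD]; apply: contraT => vB.
  have {}vD x : (reorient e A x).1 != v.
    apply: contraT; rewrite negbK => /eqP xv.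
    have := vD (reorient e A x).2 (in_setT _); rewrite negb_exists => /forallP/(_ x).
    by rewrite -xv -surjective_pairing eqxx.
  (* All reoriented arrows at [v] point into it. Raising the potential at [v] thus adds to [A] its
     unreversed edges at [v] and drops the reversed ones, so the differences stay in {0, 1}. *)
  pose p w : int := a A w + (w == v)%:R.
  pose A' := [set x | potential_difference e p x == 1].
  have A'E : indicator A' = potential_difference e p.
    apply/ffunP => x; rewrite !ffunE inE ffunE /p.
    have := AaP x; have := vD x; rewrite ffunE.
    have : (e x).1 != (e x).2.
      have := hG x; rewrite -(eqP (forall_inP eo x (in_setT _))) cards2.
      by case: eqP.
    case: (boolP (x \in A)) => /= _; case: (eqVneq (e x).1 v) => [->|_];
      case: (eqVneq (e x).2 v) => [->|_]; rewrite ?eqxx //= => *;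
      case: eqP; lia.
  have A'cut : A' \in cuts e.
    by rewrite inE; apply/asboolP; rewrite A'E; exact: potential_difference_is_tension.
  have [aE' a0'] := aP A' A'cut.
  have pE : a A' =1 p.
    apply: (potential_difference_inj eo) => [|w wB]; first by rewrite -aE' A'E.
    rewrite a0' // /p a0 // add0r; case: eqP => // wv.
    by rewrite -wv wB in vB.
  have := Amax A' A'cut; rewrite (eq_bigr _ (fun w _ => pE w)) big_split /=.
  rewrite gerDl (bigD1 v) //= big1 => [|w /negbTE -> //].
  by rewrite eqxx addr0.
apply/eqP; rewrite eqEsubset; apply/andP; split; first by apply/subsetP.
(* By acyclicity the component of [b] contains a sink; by the first inclusion this sink is a base
   point, hence [b] itself. *)
apply/subsetP => b bB; pose U := [set v | base_point v == b].
have Uarc v w : arc (reorient e A) v w -> base_point v = base_point w.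
  move=> /existsP[x /eqP xE].
  by have := base_point_arrow (reorient_orientation A eo) x; rewrite xE.
have : U != set0 by apply/set0Pn; exists b; rewrite inE base_point_id.
have At : is_tension e (indicator A) by move: Acut; rewrite inE => /asboolP.
move=> /(acyclic_sinks hG (reorient_orientation A eo) (reorient_cut_acyclic hG eo eA At)).
move=> /set0Pn[v]; rewrite inE => /andP[vU /forall_inP vD].
have vS : v \in sinks (arc (reorient e A)) setT.
  rewrite !inE; apply/forall_inP => w _; apply/negP => vw.
  have := vD w; rewrite !inE -(Uarc _ _ vw) vw => /(_ _)/negP; apply=> //.
  by move: vU; rewrite inE.
by move: vU; rewrite inE base_point_id ?sinkB // => /eqP <-.
Qed.

(* Arcs of the reorientation along the cut of a' cannot leave the set where
   a - a' is maximal, so a sink in this set is a base point. *)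
Lemma cut_potential_le (A A' : {set edge G}) (a a' : vertex G -> int) :
  acyclic e -> A' \in cuts e ->
  sinks (arc (reorient e A')) setT = base_points ->
  indicator A = potential_difference e a ->
  indicator A' = potential_difference e a' ->
  {in base_points, a =1 a'} -> forall v, a v <= a' v.
Proof.
move=> eA; rewrite inE => /asboolP At' sA' /ffunP aE /ffunP aE' aa' v0.
case: (@arg_maxP _ _ _ v0 xpredT (fun v => a v - a' v) isT) => m _ mmax.
suff am : a m = a' m.
  by have := mmax v0 isT; rewrite /= am subrr subr_le0.
pose U := [set v | a v - a' v == a m - a' m].
(* Along such an arc a - a' cannot decrease: off [A'] the change of a' is 0 and that of a is at
   least 0; on [A'] the change of a' is -1 and that of a is at least -1. *)
have Uarc v w : v \in U -> arc (reorient e A') v w -> w \in U.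
  rewrite !inE => /eqP vU /existsP[x /eqP xE].
  have := mmax w isT; have := aE x; have := aE' x; rewrite /= !ffunE.
  move: xE; rewrite ffunE; case: (x \in A') => /=; case: (x \in A) => /=;
    move=> xE; move: (congr1 fst xE) (congr1 snd xE) => /= -> ->; lia.
have /set0Pn[v] : sinks (arc (reorient e A')) U != set0.
  apply: (acyclic_sinks hG (reorient_orientation A' eo) (reorient_cut_acyclic hG eo eA At')).
  by apply/set0Pn; exists m; rewrite inE.
rewrite inE => /andP[vU /forall_inP vD].
have : v \in sinks (arc (reorient e A')) setT.
  rewrite !inE; apply/forall_inP => w _; apply/negP => vw.
  by have := vD w (Uarc v w vU vw); rewrite vw.
rewrite sA' => /aa' av; move: vU; rewrite inE av subrr eq_sym subr_eq0.
by move/eqP.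
Qed.

Lemma cut_sinks_base_points_unique (A A' : {set edge G}) :
  acyclic e -> A \in cuts e -> A' \in cuts e ->
  sinks (arc (reorient e A)) setT = base_points ->
  sinks (arc (reorient e A')) setT = base_points -> A = A'.
Proof.
move=> eA Ac Ac' sA sA'.
have At : is_tension e (indicator A) by move: Ac; rewrite inE => /asboolP.
have At' : is_tension e (indicator A') by move: Ac'; rewrite inE => /asboolP.
have [a aE a0] := normalised_potential hG eo (fun=> 0) At.
have [a' aE' a0'] := normalised_potential hG eo (fun=> 0) At'.
have aa v : a v = a' v.
  by apply: le_anti; rewrite (cut_potential_le eA Ac' sA' aE aE') ?(cut_potential_le eA Ac sA aE' aE) // => b bB;
    rewrite a0 // a0'.
apply/setP => x; have /ffunP/(_ x) := aE; have /ffunP/(_ x) := aE'.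
by rewrite !ffunE !aa => <-; case: (x \in A); case: (x \in A').
Qed.

(** One polynomial N is seen in two ways. The expansion over top levels gives polynomiality, the
    value at 0 and the degree. Multiplied by X^k(G), N is a sum of order polynomials on all
    vertices, whose reciprocity passes to N. *)
Lemma orientation_polynomial :
  acyclic e ->
  exists N : {poly R},
    [/\ forall q, (0 < q)%N -> N.[q%:R] = (tension_count true q)%:R,
        forall q, (0 < q)%N ->
          ((-1) ^+ rank G *: (N \Po - 'X)).[q%:R] = (tension_count false q)%:R,
        N.[0] = (-1) ^+ rank G,
        (size N <= (rank G).+1)%N
      & 0 < N`_(rank G)].
Proof.
move=> eA.
have sE A : A \in cuts e -> forall U : {set vertex G}, U != set0 ->
    sinks (arc (reorient e A)) U != set0.
  rewrite inE => /asboolP At U.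
  exact: (acyclic_sinks hG (reorient_orientation A eo) (reorient_cut_acyclic hG eo eA At)).
have /fin_all_exists[S SP] (z : {set edge G} * {set vertex G}) : exists S : {poly R},
    z.1 \in cuts e -> is_order_polynomial (arc (reorient e z.1)) z.2 S.
  case: (boolP (z.1 \in cuts e)) => [zc|_]; last by exists 0.
  by have [S SP] := order_polynomial_exists R (sE _ zc) z.2; exists S.
pose K A := sinks (arc (reorient e A)) setT.
have [N NE] : exists N, N = \sum_(A in cuts e)
    \sum_(J : {set vertex G} | (base_points \subset J) && (J \subset K A))
      (S (A, ~: J) \Po ('X - 1%:P)) by eexists.
have cV : (rank G + components G = #|vertex G|)%N.
  by rewrite /rank -card_base_points subnK // max_card.
have cB : #|~: base_points| = rank G.
  by apply/eqP; rewrite -(eqn_add2r (components G)) cV -card_base_points addnC cardsC.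
have cJ (J : {set vertex G}) : base_points \subset J -> (#|~: J| <= rank G)%N.
  by move=> BJ; rewrite -cB subset_leq_card // setCS.
have Nq q : (0 < q)%N -> N.[q%:R] = (tension_count true q)%:R.
  case: q => // M _; rewrite tension_count_strict NE horner_sum natr_sum.
  apply: eq_bigr => A Ac; rewrite horner_sum natr_sum; apply: eq_bigr => J _.
  rewrite horner_comp hornerXsubC -natr1 addrK.
  by have [SE _ _ _] := SP (A, ~: J) Ac; exact: SE (leqnSn M).
have XN : 'X^(components G) * N = \sum_(A in cuts e) S (A, setT).
  apply: poly_eq_at_positive_nat => -[//|M _].
  rewrite hornerM hornerXn Nq // -natrX -natrM -sum_card_monotone_maps.
  rewrite horner_sum natr_sum; apply: eq_bigr => A Ac.
  by have [SE _ _ _] := SP (A, setT) Ac; exact/esym/SE.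
have Nbarq q : (0 < q)%N ->
    ((-1) ^+ rank G *: (N \Po - 'X)).[q%:R] = (tension_count false q)%:R.
  case: q => // M _; rewrite hornerZ horner_comp hornerN hornerX.
  have q0 : M.+1%:R ^+ components G != 0 :> R by rewrite expf_neq0 // pnatr_eq0.
  apply: (mulfI q0); rewrite -natrX -natrM -sum_card_monotone_maps.
  (* Order reciprocity contributes (-1)^|V| and the factor (-q)^k(G) contributes (-1)^k(G); together
     they leave (-1)^r(G). *)
  have E : (-1) ^+ components G * (M.+1%:R ^+ components G * N.[- M.+1%:R]) =
    (-1) ^+ #|vertex G| * \sum_(A in cuts e)
     #|monotone_maps (arc (reorient e A)) false M [set: vertex G] M.+1|%:R.
    rewrite mulrA -exprNn -hornerXn -hornerM XN horner_sum mulr_sumr.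
    apply: eq_bigr => A Ac.
    by have [_ SE _ _] := SP (A, setT) Ac; rewrite (SE M M.+1) // cardsT.
  move: E; rewrite -cV addnC exprD -mulrA => /lreg_sign E.
  by rewrite natrX mulrCA E mulrA -expr2 sqrr_sign mul1r natr_sum.
have [A0 A0c sA0] := cut_sinks_base_points_exists eA.
exists N; split=> //.
(* At 0 each order polynomial is evaluated at -1, where there is a single weak map and only the sign
   remains. The alternating sum over [J] keeps the cuts whose sinks are exactly the base points. *)
- transitivity (\sum_(A in cuts e) (-1) ^+ rank G * (base_points == K A)%:R : R).
    rewrite NE horner_sum; apply: eq_bigr => A Ac; rewrite horner_sum.
    rewrite -cB -sum_sign_between; apply: eq_bigr => J _.
    rewrite horner_comp hornerXsubC sub0r; have [_ SE _ _] := SP (A, ~: J) Ac.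
    by have := SE 0 1 isT; rewrite card_monotone_maps1 mulr1.
  rewrite (bigD1 A0) //= big1 => [|A /andP[Ac AA0]].
    by rewrite /K sA0 eqxx mulr1 addr0.
  case: eqP => [KA|_]; last by rewrite mulr0.
  by rewrite (cut_sinks_base_points_unique eA Ac A0c) ?eqxx in AA0.
- rewrite NE; apply: (leq_trans (size_sum _ _ _)); apply/bigmax_leqP => A Ac.
  apply: (leq_trans (size_sum _ _ _)); apply/bigmax_leqP => J /andP[BJ _].
  rewrite size_comp_poly2 ?size_XsubC //; have [_ _ sz _] := SP (A, ~: J) Ac.
  by apply: (leq_trans sz); rewrite ltnS; exact: cJ.
have Scoef A (J : {set vertex G}) : A \in cuts e -> base_points \subset J ->
    0 <= (S (A, ~: J) \Po ('X - 1%:P))`_(rank G).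
  move=> Ac BJ; have [_ _ sz co] := SP (A, ~: J) Ac.
  rewrite coef_comp_XsubC; last by rewrite (leq_trans sz) // ltnS; exact: cJ.
  have := cJ J BJ; rewrite leq_eqVlt => /orP[/eqP <-|lt]; first exact: ltW.
  by rewrite nth_default // (leq_trans sz).
(* All contributions in degree [rank G] are nonnegative, and the cut [A0] with [J] equal to the base
   points gives a positive one. *)
rewrite NE coef_sum (bigD1 A0) //= ltr_pwDl //; last first.
  apply: sumr_ge0 => A /andP[Ac _]; rewrite coef_sum; apply: sumr_ge0 => J /andP[BJ _].
  exact: Scoef.
have BB : (base_points \subset base_points) && (base_points \subset K A0).
  by rewrite /K sA0 subxx.
rewrite coef_sum (bigD1 base_points) //= ltr_pwDl //; last first.
  by apply: sumr_ge0 => J /andP[/andP[BJ _] _]; exact: Scoef.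
have [_ _ sz co] := SP (A0, ~: base_points) A0c; rewrite coef_comp_XsubC -?cB //.
Qed.

End Counting.

End OrientationPolynomial.

(** * Lattice points of the dilated polytopes *)

Section Ehrhart.
Variables (R : realType) (G : multigraph).
Hypothesis hG : loopless G.

Definition real_of (f : {ffun edge G -> int}) : {ffun edge G -> R} :=
  [ffun x => (f x)%:~R].

Lemma real_of_inj : injective real_of.
Proof.
move=> f f' /ffunP E; apply/ffunP => x; have := E x; rewrite !ffunE.
exact: intr_inj.
Qed.

Section Orientation.
Variable e : arrows G.
Hypothesis eo : is_orientation (whole G) e.

Lemma real_of_tension (f : {ffun edge G -> int}) :
  is_tension e (real_of f) <-> is_tension e f.
Proof.
have E (C : subgraph G) (eC : arrows G) : \sum_(x in C.2) real_of f x *~ coupling (whole G) e C eC x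
    = (\sum_(x in C.2) f x *~ coupling (whole G) e C eC x)%:~R.
  by rewrite rmorph_sum; apply: eq_bigr => x _; rewrite ffunE rmorphMz.
split=> ft C eC Cc Cd; last by rewrite E ft.
by apply/eqP; rewrite -(intr_eq0 R) -E ft.
Qed.

Lemma tension_scale (c : R) (f : {ffun edge G -> R}) :
  is_tension e f -> is_tension e [ffun x => c * f x].
Proof.
move=> ft C eC Cc Cd; under eq_bigr do rewrite ffunE -mulrzAr.
by rewrite -mulr_sumr ft ?mulr0.
Qed.

Lemma tension_linear_combination (n : nat) (w : 'I_n -> R)
    (p : 'I_n -> {ffun edge G -> R}) (f : {ffun edge G -> R}) :
  (forall i, is_tension e (p i)) -> (forall x, f x = \sum_i w i * p i x) ->
  is_tension e f.
Proof.
move=> pt fE C eC Cc Cd.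
transitivity (\sum_i w i * \sum_(x in C.2) p i x *~ coupling (whole G) e C eC x).
  under [RHS]eq_bigr do rewrite mulr_sumr; rewrite exchange_big /=.
  apply: eq_bigr => x _; rewrite fE -mulrzr mulr_suml.
  by apply: eq_bigr => i _; rewrite -mulrA mulrzr.
by rewrite big1 // => i _; rewrite pt // mulr0.
Qed.

Lemma real_of_floor (t : {ffun edge G -> R}) :
  integer_points R (edge G) t -> real_of [ffun x => Num.floor (t x)] = t.
Proof. by move=> tZ; apply/ffunP => x; rewrite !ffunE floorK. Qed.

Lemma open_polytope_points (q : nat) (t : {ffun edge G -> R}) : (0 < q)%N ->
  (dilation q (open_tension_polytope R e) `&` integer_points R (edge G))%classic t <->
  exists2 f, is_tension e f /\ within true q f & real_of f = t.
Proof.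
move=> q0; have q0R : 0 < q%:R :> R by rewrite ltr0n.
split=> [[[g [gt g01] <-] tZ]|[f [ft fq] <-]].
  exists [ffun x => Num.floor ([ffun x => q%:R * g x] x)]; last exact: real_of_floor.
  split; first by apply/real_of_tension; rewrite real_of_floor //; exact: tension_scale.
  move=> x; have /ffunP/(_ x) := real_of_floor tZ; rewrite !ffunE => fE.
  have /andP[g0 g1] := g01 x.
  by rewrite -(ltr0z R) -(ltr_int R) fE mulr_gt0 //= -[ltRHS]mulr1 ltr_pM2l.
split; last by move=> x; rewrite ffunE intr_int.
exists [ffun x => q%:R^-1 * real_of f x].
  split; first exact/tension_scale/real_of_tension.
  move=> x; have /andP[f0 f1] := fq x; rewrite !ffunE.
  rewrite mulr_gt0 ?invr_gt0 ?ltr0z //= mulrC ltr_pdivrMr // mul1r.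
  by rewrite -(ltr_int R) in f1.
by apply/ffunP => x; rewrite !ffunE mulVKf // gt_eqF.
Qed.

(* f = q 1_A + db is the sum over i < q of the 0/1 tensions 1_A + d[i < b]. *)
Lemma closed_polytope_points (q : nat) (t : {ffun edge G -> R}) : (0 < q)%N ->
  (dilation q (closed_tension_polytope R e) `&` integer_points R (edge G))%classic t <->
  exists2 f, is_tension e f /\ within false q f & real_of f = t.
Proof.
move=> q0; have q0R : 0 < q%:R :> R by rewrite ltr0n.
split=> [[[g [n [w [p [p01 w0 w1 gE]]]] <-] tZ]|[f [ft fq] <-]].
  exists [ffun x => Num.floor ([ffun x => q%:R * g x] x)]; last exact: real_of_floor.
  split.
    apply/real_of_tension; rewrite real_of_floor //; apply: tension_scale.
    by apply: (tension_linear_combination _ gE) => i; have [] := p01 i.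
  move=> x; have /ffunP/(_ x) := real_of_floor tZ; rewrite !ffunE => fE.
  have p01x i : 0 <= p i x <= 1.
    by have [_ /(_ x)[->|->]] := p01 i; rewrite lexx ler01.
  rewrite -(ler0z R) -(ler_int R) fE mulr_ge0 ?(ltW q0R) //=.
    rewrite -[leRHS]mulr1 ler_pM2l // gE -w1; apply: ler_sum => i _.
    by have /andP[_ p1] := p01x i; rewrite -[leRHS]mulr1 ler_wpM2l.
  rewrite gE; apply: sumr_ge0 => i _; apply: mulr_ge0 => //.
  by have /andP[] := p01x i.
split; last by move=> x; rewrite ffunE intr_int.
case: q q0 q0R fq => // M _ q0R fq.
have [[A b] + fE] := proj1 (assemble_image hG eo false [ffun=> ord0] f) (conj ft fq).
rewrite inE /= => /and3P[]; rewrite inE => /asboolP At /monotone_arcP bD _.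
pose g (i : 'I_M.+1) : {ffun edge G -> int} :=
  [ffun x => indicator A x + potential_difference e (fun v => (i < b v)%N%:Z) x].
exists [ffun x => M.+1%:R^-1 * real_of f x]; last first.
  by apply/ffunP => x; rewrite !ffunE mulVKf // gt_eqF.
exists M.+1, (fun=> M.+1%:R^-1), (fun i => real_of (g i)); split=> [i|i||x].
- split.
    apply/real_of_tension; have [a aE _] := normalised_potential hG eo (fun=> 0) At.
    have -> : g i = potential_difference e (fun v => a v + (i < b v)%N%:Z).
      by apply/ffunP => x; have /ffunP/(_ x) := aE; rewrite !ffunE; lia.
    exact: potential_difference_is_tension.
  (* Weak monotonicity of [b] along the reorientation makes the threshold difference 0 or 1 off [A],
     and 0 or -1 on [A]. *)
  move=> x; have : g i x = 0 \/ g i x = 1.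
    by have := bD x; rewrite /= !ffunE; case: (x \in A) => /=; lia.
  by rewrite [real_of _ _]ffunE => -[->|->]; [left|right].
- by rewrite invr_ge0 ltW.
- by rewrite sumr_const card_ord -[LHS]mulr_natr mulVf // gt_eqF.
rewrite -mulr_sumr ffunE -fE; congr (_ * _).
transitivity ((\sum_(i < M.+1) g i x)%:~R : R); last first.
  by rewrite rmorph_sum; apply: eq_bigr => i _; rewrite [RHS]ffunE.
(* Exactly [b v] thresholds [i] lie below [b v], so summing over [i] returns q 1_A + db. *)
rewrite ffunE; congr (_%:~R); have sumb v : \sum_(i < M.+1) (i < b v)%N%:Z = b v.
  have -> : (b v)%:Z = \sum_(i < b v) 1 by rewrite sumr_const card_ord natz.
  rewrite (big_ord_widen M.+1 (fun=> 1)) ?(ltnW (ltn_ord _)) // [RHS]big_mkcond.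
  by apply: eq_bigr => i _; case: ifP.
rewrite ffunE /= [RHS](eq_bigr (fun i : 'I_M.+1 => indicator A x +
    ((i < b (e x).2)%N%:Z - (i < b (e x).1)%N%:Z))) => [|i _]; last by rewrite !ffunE.
rewrite big_split sumr_const card_ord sumrB !sumb !ffunE.
by rewrite -[M.+1%:Z]natz mulr_natl.
Qed.

Lemma ehrhart_open_polytope (N : {poly R}) :
  (forall q, (0 < q)%N -> N.[q%:R] = (tension_count e true q)%:R) ->
  ehrhart_polynomial (open_tension_polytope R e) N.
Proof.
move=> NE [//|M] q0; rewrite NE // -(card_residues hG eo true [ffun=> ord0]); congr _%:R.
apply/esym/(count_image (h := real_of \o @assemble _ e M)).
  by move=> z z' zr zr' /real_of_inj; exact: (assemble_inj hG eo zr zr').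
move=> t; rewrite open_polytope_points //; split=> [[f fP <-]|[z zr <-]].
  have [z zr zf] := proj1 (assemble_image hG eo true [ffun=> ord0] f) fP.
  by exists z; rewrite //= zf.
by exists (assemble e z) => //; apply/(assemble_image hG eo true [ffun=> ord0]); exists z.
Qed.

Lemma ehrhart_closed_polytope (N : {poly R}) :
  (forall q, (0 < q)%N -> N.[q%:R] = (tension_count e false q)%:R) ->
  ehrhart_polynomial (closed_tension_polytope R e) N.
Proof.
move=> NE [//|M] q0; rewrite NE // -(card_residues hG eo false [ffun=> ord0]); congr _%:R.
apply/esym/(count_image (h := real_of \o @assemble _ e M)).
  by move=> z z' zr zr' /real_of_inj; exact: (assemble_inj hG eo zr zr').
move=> t; rewrite closed_polytope_points //; split=> [[f fP <-]|[z zr <-]].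
  have [z zr zf] := proj1 (assemble_image hG eo false [ffun=> ord0] f) fP.
  by exists z; rewrite //= zf.
by exists (assemble e z) => //; apply/(assemble_image hG eo false [ffun=> ord0]); exists z.
Qed.

End Orientation.

(** * Summation over acyclic orientations *)

Lemma reorient_difference (e e' : arrows G) :
  is_orientation (whole G) e -> is_orientation (whole G) e' ->
  e' = reorient e [set x | e x != e' x].
Proof.
move=> eo eo'; apply/ffunP => x; rewrite ffunE inE.
case: eqVneq => //= ee'.
have := forall_inP eo x (in_setT _); have := hG x.
rewrite -(eqP (forall_inP eo' x (in_setT _))).
case: (e x) (e' x) ee' => [a b] [a' b'] /= ee'; rewrite cards2.
case: eqVneq => //= ab' _ /eqP/setP E.
have := E a; have := E b; have := E a'; have := E b'.
rewrite !inE !eqxx !orbT /=.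
move=> /orP b'E /orP a'E _ /esym/orP[/eqP aE|/eqP aE].
  by case: b'E ee' ab' => /eqP ->; rewrite aE eqxx.
by case: a'E ab' => /eqP ->; rewrite aE // eqxx.
Qed.

Section Orientations.
Variables (strict : bool) (M : nat).
Local Notation data := (arrows G * ({set edge G} * {ffun vertex G -> 'I_M.+1}))%type.

Definition oriented_residues : {set data} :=
  [set z : data | (z.1 \in acyclic_orientations G) &&
     (z.2 \in residues z.1 strict [ffun=> ord0])].

Lemma mem_oriented_residues (z : data) :
  (z \in oriented_residues) =
  (z.1 \in acyclic_orientations G) && (z.2 \in residues z.1 strict [ffun=> ord0]).
Proof. exact: in_set. Qed.

Lemma card_oriented_residues :
  #|oriented_residues| =
  (\sum_(e in acyclic_orientations G) tension_count e strict M.+1)%N.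
Proof.
transitivity (\sum_(e in acyclic_orientations G)
   #|residues e strict ([ffun=> ord0] : {ffun vertex G -> 'I_M.+1})|)%N.
  rewrite -sum1_card [RHS](eq_bigr _ (fun e _ => esym (sum1_card _))).
  by rewrite pair_big_dep /=; apply: eq_bigl => z; rewrite in_set.
by apply: eq_bigr => e; rewrite inE => /andP[eo _]; exact: card_residues.
Qed.

End Orientations.

Lemma bar_tauZ_sum (q : nat) : (0 < q)%N ->
  bar_tauZ G q = (\sum_(e in acyclic_orientations G) tension_count e false q)%N.
Proof.
case: q => // M _; rewrite -card_oriented_residues.
apply: (count_image (h := fun z => (z.1, assemble z.1 z.2))).
  move=> [e z] [e' z']; rewrite !mem_oriented_residues /= => /andP[eA zr] /andP[_ zr'] [ee'].
  rewrite -ee' in zr' *; move=> zz'; congr (_, _).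
  by move: eA; rewrite inE => /andP[eo _]; exact: (assemble_inj hG eo zr zr').
move=> [e f]; split=> [[/= eA ft fq]|[[e' z]]].
  have eo : is_orientation (whole G) e by move: eA; rewrite inE => /andP[].
  have [z zr zf] := proj1 (assemble_image hG eo false [ffun=> ord0] f) (conj ft fq).
  by exists (e, z); rewrite /= ?zf // mem_oriented_residues eA.
rewrite mem_oriented_residues /= => /andP[eA zr] [<- <-].
have eo : is_orientation (whole G) e' by move: eA; rewrite inE => /andP[].
have [ft fq] := proj2 (assemble_image hG eo false _ _) (ex_intro2 _ _ z zr erefl).
by split.
Qed.

(* Reorienting along the edges on which a nowhere-zero tension is negative
   makes it positive, so that the new orientation is acyclic. *)
Lemma tauZ_sum (e : arrows G) (q : nat) :
  is_orientation (whole G) e -> (0 < q)%N ->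
  tauZ e q = (\sum_(e' in acyclic_orientations G) tension_count e' true q)%N.
Proof.
move=> eo; case: q => // M _; rewrite -card_oriented_residues.
(* Flipping signs where [e'] disagrees with [e] turns a tension of [e'] into one of [e]. *)
pose F (e' : arrows G) := [set x | e x != e' x].
have eF e' : e' \in acyclic_orientations G -> e' = reorient e (F e').
  by rewrite inE => /andP[eo' _]; exact: reorient_difference.
have pos e' z : e' \in acyclic_orientations G ->
    z \in residues e' true ([ffun=> ord0] : {ffun vertex G -> 'I_M.+1}) ->
    is_tension e' (assemble e' z) /\ within true M.+1 (assemble e' z).
  move=> e'A zr; have eo' : is_orientation (whole G) e' by move: e'A; rewrite inE => /andP[].
  by apply/(assemble_image hG eo' true [ffun=> ord0]); exists z.
apply: (count_image (h := fun z => sign_flip (F z.1) (assemble z.1 z.2))).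
  move=> [e1 z1] [e2 z2]; rewrite !mem_oriented_residues /= => /andP[eA1 zr1] /andP[eA2 zr2] /ffunP E.
  (* The assembled tensions are positive, so the negative entries of the common image are exactly
     the edges of [F e1] and of [F e2], and this set determines the orientation. *)
  have e12 : e1 = e2.
    rewrite (eF _ eA1) (eF _ eA2); congr reorient; apply/setP => x.
    have [_ /(_ x)] := pos _ _ eA1 zr1; have [_ /(_ x)] := pos _ _ eA2 zr2.
    have := E x; rewrite [LHS]ffunE [RHS]ffunE.
    move: (assemble e1 z1 x) (assemble e2 z2 x) => m1 m2.
    by case: (x \in F e1); case: (x \in F e2) => //=; lia.
  rewrite -e12 in zr2 E *; congr (_, _).
  have eo1 : is_orientation (whole G) e1 by move: eA1; rewrite inE => /andP[].
  apply: (assemble_inj hG eo1 zr1 zr2); apply: (can_inj (@sign_flipK _ _ (F e1))).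
  exact/ffunP.
move=> f; split=> [[ft f0 fq]|[[e' z]]]; last first.
  rewrite mem_oriented_residues /= => /andP[e'A zr] <-; have [ft fq] := pos _ _ e'A zr.
  have eo' : is_orientation (whole G) e' by move: e'A; rewrite inE => /andP[].
  split=> [|x|x].
  - have := tension_reorient hG (F e') eo' ft.
    by rewrite {1}(eF _ e'A) reorientK.
  - by have := fq x; rewrite [sign_flip _ _ _]ffunE; move: (assemble e' z x) => m /=; case: ifP; lia.
  - by have := fq x; rewrite [sign_flip _ _ _]ffunE; move: (assemble e' z x) => m /=; case: ifP; lia.
pose A := [set x | f x < 0].
have ft' := tension_reorient hG A eo ft.
have fq' : within true M.+1 (sign_flip A f).
  move=> x; rewrite ffunE inE; have := f0 x; have := fq x.
  by move: (f x) => m /=; case: ifP; lia.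
have eo' := reorient_orientation A eo.
have e'A : reorient e A \in acyclic_orientations G.
  rewrite inE eo'; apply: (positive_tension_acyclic ft') => x.
  by have /andP[] := fq' x.
have [z zr zf] := proj1 (assemble_image hG eo' true [ffun=> ord0] _) (conj ft' fq').
exists (reorient e A, z); first by rewrite mem_oriented_residues /= e'A.
(* Without loops a reversed arrow differs from the original, so the orientations disagree on all of
   [A]. *)
rewrite /= zf; have -> : F (reorient e A) = A; last exact: sign_flipK.
apply/setP => x; rewrite in_set ffunE; case: (boolP (x \in A)) => xA; last by rewrite eqxx.
have := hG x; rewrite -(eqP (forall_inP eo x (in_setT _))) cards2.
rewrite [e x]surjective_pairing xpair_eqE /=.
by case: eqVneq => //= /negbTE ->.
Qed.

End Ehrhart.

(** * Degree, reciprocity and values at zero of the summed polynomials *)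

Theorem theorem1p2 (R : realType) (G : multigraph) (hG : loopless G) :
  exists (tau bar_tau : {poly R}) (tau_e bar_tau_e : arrows G -> {poly R}),
    (forall (e : arrows G) (q : nat), is_orientation (whole G) e -> (0 < q)%N ->
        tau.[q%:R] = (tauZ e q)%:R) /\
    (forall q : nat, (0 < q)%N -> bar_tau.[q%:R] = (bar_tauZ G q)%:R) /\
    size tau = (rank G).+1 /\
    size bar_tau = (rank G).+1 /\
    (forall e : arrows G, e \in acyclic_orientations G ->
        ehrhart_polynomial (open_tension_polytope R e) (tau_e e) /\
        ehrhart_polynomial (closed_tension_polytope R e) (bar_tau_e e)) /\
    tau = \sum_(e in acyclic_orientations G) tau_e e /\
    bar_tau = \sum_(e in acyclic_orientations G) bar_tau_e e /\
    (forall e : arrows G, e \in acyclic_orientations G ->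
        tau_e e \Po (- 'X) = (-1) ^+ rank G *: bar_tau_e e) /\
    tau \Po (- 'X) = (-1) ^+ rank G *: bar_tau /\
    (forall e : arrows G, e \in acyclic_orientations G ->
        (bar_tau_e e).[0] = (-1) ^+ rank G * (tau_e e).[0] /\
        (bar_tau_e e).[0] = 1) /\
    `|tau.[0]| = #|acyclic_orientations G|%:R.
Proof.
set AO := acyclic_orientations G; set r := rank G.
have AOo e : e \in AO -> is_orientation (whole G) e by rewrite inE => /andP[].
have /fin_all_exists[N NP] (e : arrows G) : exists N : {poly R}, e \in AO ->
    [/\ forall q, (0 < q)%N -> N.[q%:R] = (tension_count e true q)%:R,
        forall q, (0 < q)%N ->
          ((-1) ^+ r *: (N \Po - 'X)).[q%:R] = (tension_count e false q)%:R,
        N.[0] = (-1) ^+ r, (size N <= r.+1)%N & 0 < N`_r].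
  case: (boolP (e \in AO)) => [|_]; last by exists 0.
  rewrite inE => /andP[eo eA]; have [N NP] := orientation_polynomial R hG eo eA.
  by exists N.
(* The closed polynomials are obtained from the open ones by reciprocity itself; that they count the
   weak tensions is part of [NP]. *)
pose bar (p : {poly R}) := (-1) ^+ r *: (p \Po - 'X).
have barK p : p \Po - 'X = (-1) ^+ r *: bar p.
  by rewrite scalerA -expr2 sqrr_sign scale1r.
have bar0 p : (bar p).[0] = (-1) ^+ r * p.[0].
  by rewrite hornerZ horner_comp hornerN hornerX oppr0.
have bar_sum : bar (\sum_(e in AO) N e) = \sum_(e in AO) bar (N e).
  by rewrite /bar linear_sum scaler_sumr.
have sz : size (\sum_(e in AO) N e) = r.+1.
  apply/eqP; rewrite eqn_leq; apply/andP; split.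
    apply: (leq_trans (size_sum _ _ _)); apply/bigmax_leqP => e eA.
    by have [] := NP e eA.
  (* The coefficients of degree [r] are all positive and at least one orientation occurs, so they
     cannot cancel. *)
  rewrite ltnNge; apply/negP => /leq_sizeP/(_ r (leqnn r))/eqP; apply/negP.
  have /set0Pn[e0 eA0] := acyclic_orientation_exists hG.
  rewrite coef_sum (bigD1 e0) //= gt_eqF // ltr_pwDl //; first by have [] := NP e0 eA0.
  by apply: sumr_ge0 => e /andP[eA _]; apply: ltW; have [] := NP e eA.
exists (\sum_(e in AO) N e), (bar (\sum_(e in AO) N e)), N, (fun e => bar (N e)).
split=> [e q eo q0|].
  rewrite (tauZ_sum hG eo q0) horner_sum natr_sum.
  by apply: eq_bigr => e' eA; have [NE _ _ _ _] := NP e' eA; exact: NE.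
split=> [q q0|].
  rewrite (bar_tauZ_sum hG q0) bar_sum horner_sum natr_sum.
  by apply: eq_bigr => e' eA; have [_ NE _ _ _] := NP e' eA; exact: NE.
split=> //.
split; first by rewrite size_scale ?signr_eq0 // size_comp_poly2 // size_polyN size_polyX.
split=> [e eA|].
  have [NE barE _ _ _] := NP e eA; split.
    exact: (ehrhart_open_polytope hG (AOo e eA)).
  exact: (ehrhart_closed_polytope hG (AOo e eA)).
split=> //; split=> //; split=> [e _|]; first exact: barK.
split; first exact: barK.
split=> [e eA|].
  by have [_ _ N0 _ _] := NP e eA; rewrite bar0 N0 -expr2 sqrr_sign.
(* All constant terms equal the same sign, so the absolute value of their sum counts the
   orientations. *)
rewrite horner_sum (eq_bigr (fun=> (-1) ^+ r)) => [|e eA]; last by have [] := NP e eA.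
by rewrite sumr_const -[X in `|X|]mulr_natr normrM normr_sign mul1r ger0_norm.
Qed.
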